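(* Let $k$ be a commutative ring and $G$ a finite group. A $kG$-module $M$ is cw-injective if and only if $M_{\mathfrak p}$ is a cw-injective $k_{\mathfrak p}G$-module for every maximal ideal $\mathfrak p\subseteq k$.
   Context: A short exact sequence of $kG$-modules is $k$-split exact if it splits after restriction to $k$-modules. A $kG$-module $P$ is weakly injective if $\mathrm{Hom}_{kG}(-,P)$ preserves exactness of $k$-split exact sequences. A $kG$-module is cw-injective if it is isomorphic in the category of $kG$-modules to a filtered colimit of weakly injective $kG$-modules. The same definitions apply with $k_{\mathfrak p}$ in place of $k$. $M_{\mathfrak p}=k_{\mathfrak p}\otimes_k M$ is the localisation of $M$ at $\mathfrak p$. *)

(* Defs.v *)
From HB Require Import structures.
From mathcomp Require Import all_boot all_fingroup all_algebra.
From mathcomp Require Import generic_quotient ring.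
From mathcomp Require Import boolp classical_sets.

Set Implicit Arguments.
Unset Strict Implicit.
Unset Printing Implicit Defensive.

Import GRing.Theory.
Local Open Scope ring_scope.
Local Open Scope quotient_scope.

Definition group_algebra (k : comPzRingType) (gT : finGroupType) : Type :=
  {ffun gT -> k}.

Section GroupAlgebra.
Variables (k : comPzRingType) (gT : finGroupType).
Local Notation kG := (group_algebra k gT).
Implicit Types (a b c : kG) (g h : gT).

HB.instance Definition _ := GRing.Zmodule.copy kG {ffun gT -> k}.

Definition coef (a : kG) (g : gT) : k := (a : {ffun gT -> k}) g.

Definition gbasis (g : gT) : kG := [ffun h => (h == g)%:R].

Definition gmul (a b : kG) : kG :=
  [ffun g => \sum_(h : gT) coef a h * coef b (h^-1 * g)%g].

Lemma coef_inj a b : (forall g, coef a g = coef b g) -> a = b.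
Proof. by move=> ab; apply/ffunP. Qed.

Lemma coefD a b g : coef (a + b) g = coef a g + coef b g.
Proof. by rewrite /coef ffunE. Qed.

Lemma coef_gmul a b g :
  coef (gmul a b) g = \sum_(h : gT) coef a h * coef b (h^-1 * g)%g.
Proof. by rewrite /coef ffunE. Qed.

Lemma coef_gbasis g h : coef (gbasis g) h = (h == g)%:R.
Proof. by rewrite /coef ffunE. Qed.

Fact gmulA : associative gmul.
Proof.
move=> a b c; apply: coef_inj => g; rewrite !coef_gmul.
under eq_bigr do rewrite coef_gmul mulr_sumr.
under [RHS]eq_bigr do rewrite coef_gmul mulr_suml.
rewrite [RHS]exchange_big /=; apply: eq_bigr => h _.
rewrite [RHS](reindex_inj (mulgI h)) /=; apply: eq_bigr => x _.
by rewrite mulrA mulKg invMg mulgA.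
Qed.

Fact gmul1r : left_id (gbasis 1%g) gmul.
Proof.
move=> a; apply: coef_inj => g; rewrite coef_gmul (bigD1 1%g) //= big1 => [|h h1].
  by rewrite coef_gbasis eqxx mul1r addr0 invg1 mul1g.
by rewrite coef_gbasis (negPf h1) mul0r.
Qed.

Fact gmulr1 : right_id (gbasis 1%g) gmul.
Proof.
move=> a; apply: coef_inj => g; rewrite coef_gmul (bigD1 g) //= big1 => [|h hg].
  by rewrite coef_gbasis mulVg eqxx mulr1 addr0.
by rewrite coef_gbasis -eq_mulVg1 (negPf hg) mulr0.
Qed.

Fact gmulDl : left_distributive gmul +%R.
Proof.
move=> a b c; apply: coef_inj => g; rewrite coefD !coef_gmul -big_split /=.
by apply: eq_bigr => h _; rewrite coefD mulrDl.
Qed.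

Fact gmulDr : right_distributive gmul +%R.
Proof.
move=> a b c; apply: coef_inj => g; rewrite coefD !coef_gmul -big_split /=.
by apply: eq_bigr => h _; rewrite coefD mulrDr.
Qed.

HB.instance Definition _ :=
  GRing.Zmodule_isPzRing.Build kG gmulA gmul1r gmulr1 gmulDl gmulDr.

Lemma coefM a b g :
  coef (a * b) g = \sum_(h : gT) coef a h * coef b (h^-1 * g)%g.
Proof. exact: coef_gmul. Qed.

Lemma gbasis1 : gbasis 1%g = 1. Proof. by []. Qed.

Lemma gbasisM g h : gbasis (g * h)%g = gbasis g * gbasis h.
Proof.
apply: coef_inj => x; rewrite coefM (bigD1 g) //= big1 => [|y yg].
  by rewrite !coef_gbasis eqxx mul1r addr0 (can2_eq (mulKVg g) (mulKg g)).
by rewrite !coef_gbasis (negPf yg) mul0r.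
Qed.

Definition gconst (c : k) : kG := [ffun g => c *+ (g == 1%g)].

Lemma coef_gconst (x : k) g : coef (gconst x) g = x *+ (g == 1%g).
Proof. by rewrite /coef ffunE. Qed.

Fact gconst_is_zmod_morphism : zmod_morphism gconst.
Proof.
move=> c d; apply/ffunP => g; rewrite !ffunE.
by rewrite mulrnBl.
Qed.

Fact gconst_is_monoid_morphism : monoid_morphism gconst.
Proof.
split=> [|c d]; apply: coef_inj => g.
  by rewrite coef_gconst.
rewrite [RHS]coefM (bigD1 1%g) //= big1 => [|h h1]; rewrite !coef_gconst.
  by rewrite eqxx addr0 invg1 mul1g mulrnAr.
by rewrite (negPf h1) mul0r.
Qed.

HB.instance Definition _ :=
  GRing.isZmodMorphism.Build k kG gconst gconst_is_zmod_morphism.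
HB.instance Definition _ :=
  GRing.isMonoidMorphism.Build k kG gconst gconst_is_monoid_morphism.

Lemma gconst_basisC (x : k) g : gconst x * gbasis g = gbasis g * gconst x.
Proof.
apply: coef_inj => y; rewrite !coefM (bigD1 1%g) //= big1 => [|h h1]; last first.
  by rewrite coef_gconst (negPf h1) mul0r.
rewrite [RHS](bigD1 g) //= [X in _ = _ + X]big1 => [|h hg]; last first.
  by rewrite coef_gbasis (negPf hg) mul0r.
rewrite !coef_gconst !coef_gbasis !eqxx !addr0 mul1r invg1 mul1g.
by rewrite mulr_natr -eq_mulVg1 eq_sym.
Qed.

End GroupAlgebra.

Definition restrict (R S : pzRingType) (f : {rmorphism R -> S})
  (V : lmodType S) : Type := V.

Section Restrict.
Variables (R S : pzRingType) (f : {rmorphism R -> S}) (V : lmodType S).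

HB.instance Definition _ := GRing.Zmodule.copy (restrict f V) V.

Definition restrict_scale (a : R) (v : restrict f V) : restrict f V :=
  f a *: (v : V).

Fact restrict_scaleA a b v :
  restrict_scale a (restrict_scale b v) = restrict_scale (a * b) v.
Proof. by rewrite /restrict_scale scalerA rmorphM. Qed.

Fact restrict_scale1 : left_id 1 restrict_scale.
Proof. by move=> v; rewrite /restrict_scale rmorph1 scale1r. Qed.

Fact restrict_scaleDr : right_distributive restrict_scale +%R.
Proof. by move=> a u v; rewrite /restrict_scale scalerDr. Qed.

Fact restrict_scaleDl v : {morph restrict_scale^~ v : a b / a + b}.
Proof. by move=> a b; rewrite /restrict_scale rmorphD scalerDl. Qed.

HB.instance Definition _ := GRing.Zmodule_isLmodule.Build R (restrict f V)
  restrict_scaleA restrict_scale1 restrict_scaleDr restrict_scaleDl.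

End Restrict.

Notation underlying M := (restrict (@gconst _ _) M).

Definition short_exact (R : pzRingType) (A B C : lmodType R)
    (f : {linear A -> B}) (g : {linear B -> C}) : Prop :=
  [/\ injective f,
      forall y, g y = 0 <-> exists x, y = f x
    & forall z, exists y, g y = z].

Definition is_split (R : pzRingType) (B C : lmodType R) (g : B -> C) : Prop :=
  exists s : {linear C -> B}, forall z, g (s z) = z.

Section WeaklyInjective.
Variables (k : comPzRingType) (gT : finGroupType).
Local Notation kG := (group_algebra k gT).

Definition k_split_exact (A B C : lmodType kG)
    (f : {linear A -> B}) (g : {linear B -> C}) : Prop :=
  short_exact f g /\ @is_split k (underlying B) (underlying C) g.

(* Exactness of 0 -> Hom(C, P) -> Hom(B, P) -> Hom(A, P) -> 0. *)
Definition Hom_short_exact (A B C P : lmodType kG)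
    (f : {linear A -> B}) (g : {linear B -> C}) : Prop :=
  [/\ forall h h' : {linear C -> P}, h \o g =1 h' \o g -> h =1 h',
      forall h : {linear B -> P},
        (forall x, h (f x) = 0) <-> exists h' : {linear C -> P}, h =1 h' \o g
    & forall h : {linear A -> P}, exists h' : {linear B -> P}, h =1 h' \o f].

Definition weakly_injective (P : lmodType kG) : Prop :=
  forall (A B C : lmodType kG) (f : {linear A -> B}) (g : {linear B -> C}),
    k_split_exact f g -> Hom_short_exact P f g.

End WeaklyInjective.

Record category := Category {
  object :> Type;
  hom : object -> object -> Type;
  idm : forall i, hom i i;
  hcomp : forall i j l, hom j l -> hom i j -> hom i l;
  hcomp1m : forall i j (u : hom i j), hcomp (idm j) u = u;
  hcompm1 : forall i j (u : hom i j), hcomp u (idm i) = u;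
  hcompA : forall i j l m (w : hom l m) (v : hom j l) (u : hom i j),
    hcomp w (hcomp v u) = hcomp (hcomp w v) u
}.

Definition filtered (I : category) : Prop :=
  [/\ inhabited I,
      forall i j : I, exists l : I, inhabited (hom i l) /\ inhabited (hom j l)
    & forall (i j : I) (u v : hom i j),
        exists (l : I) (w : hom j l), hcomp w u = hcomp w v].

Record diagram (I : category) (R : pzRingType) := Diagram {
  dobj :> I -> lmodType R;
  dmap : forall i j, hom i j -> {linear dobj i -> dobj j};
  dmap_id : forall i, dmap (idm i) =1 idfun;
  dmap_comp : forall i j l (v : hom j l) (u : hom i j),
    dmap (hcomp v u) =1 dmap v \o dmap u
}.

Section Colimits.
Variables (I : category) (R : pzRingType) (D : diagram I R).

Definition is_cocone (L : lmodType R) (c : forall i, {linear D i -> L}) : Prop :=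
  forall i j (u : hom i j), c j \o dmap D u =1 c i.

Definition is_colimit (L : lmodType R) (c : forall i, {linear D i -> L}) : Prop :=
  is_cocone c /\
  forall (N : lmodType R) (d : forall i, {linear D i -> N}), is_cocone d ->
    exists u : {linear L -> N}, (forall i, u \o c i =1 d i) /\
      forall u' : {linear L -> N}, (forall i, u' \o c i =1 d i) -> u' =1 u.

End Colimits.

Definition isomorphic (R : pzRingType) (M N : lmodType R) : Prop :=
  exists f : {linear M -> N}, bijective f.

Definition cw_injective (k : comPzRingType) (gT : finGroupType)
    (M : lmodType (group_algebra k gT)) : Prop :=
  exists (I : category) (D : diagram I (group_algebra k gT))
         (L : lmodType (group_algebra k gT)) (c : forall i, {linear D i -> L}),
    [/\ filtered I, forall i, weakly_injective (D i), is_colimit c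
      & isomorphic M L].

Section Tensor.
Variables (R : comPzRingType) (U V : lmodType R).

Definition is_bilinear (T : lmodType R) (f : U -> V -> T) : Prop :=
  (forall v, linear (f^~ v)) /\ (forall u, linear (f u)).

Definition eval_sum (T : lmodType R) (f : U -> V -> T) (s : seq (U * V)) : T :=
  \sum_(x <- s) f x.1 x.2.

(* The list [(u1, v1); ...; (un, vn)] stands for the formal sum of the ui (x) vi;
   two formal sums are equal in the tensor product when no bilinear map
   distinguishes them. *)
Definition tensor_eqv (s t : seq (U * V)) : bool :=
  `[< forall (T : lmodType R) (f : U -> V -> T),
        is_bilinear f -> eval_sum f s = eval_sum f t >].

Fact tensor_eqv_refl : reflexive tensor_eqv.
Proof. by move=> s; apply/asboolP. Qed.

Fact tensor_eqv_sym : symmetric tensor_eqv.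
Proof.
by move=> s t; apply: asbool_equiv_eq; split=> st T f fb; rewrite st.
Qed.

Fact tensor_eqv_trans : transitive tensor_eqv.
Proof.
move=> s t r /asboolP ts /asboolP sr; apply/asboolP => T f fb.
by rewrite (ts T f fb) (sr T f fb).
Qed.

Canonical tensor_equiv :=
  EquivRel tensor_eqv tensor_eqv_refl tensor_eqv_sym tensor_eqv_trans.

Definition tensor : Type := {eq_quot tensor_eqv}.
HB.instance Definition _ := EqQuotient.on tensor.
HB.instance Definition _ := Choice.on tensor.

Definition pure (u : U) (v : V) : tensor := \pi_tensor [:: (u, v)].

Definition tensor_lift (T : lmodType R) (f : U -> V -> T) (t : tensor) : T :=
  eval_sum f (repr t).

Lemma tensor_lift_pi (T : lmodType R) (f : U -> V -> T) s :
  is_bilinear f -> tensor_lift f (\pi_tensor s) = eval_sum f s.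
Proof.
move=> fb; rewrite /tensor_lift; case: piP => t /eqmodP /asboolP st.
by rewrite (st T f fb).
Qed.

Lemma tensor_ext (x y : tensor) :
  (forall (T : lmodType R) (f : U -> V -> T),
     is_bilinear f -> tensor_lift f x = tensor_lift f y) -> x = y.
Proof.
move=> xy; rewrite -[x]reprK -[y]reprK; apply/eqmodP/asboolP => T f fb.
exact: xy.
Qed.

Lemma tensor_lift_pure (T : lmodType R) (f : U -> V -> T) u v :
  is_bilinear f -> tensor_lift f (pure u v) = f u v.
Proof. by move=> fb; rewrite tensor_lift_pi // /eval_sum big_seq1. Qed.

Definition tzero : tensor := \pi_tensor [::].
Definition tadd (x y : tensor) : tensor := \pi_tensor (repr x ++ repr y).
Definition tscale (a : R) (x : tensor) : tensor :=
  \pi_tensor [seq (a *: z.1, z.2) | z <- repr x].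
Definition topp : tensor -> tensor := tscale (-1).

Section Lift.
Variables (T : lmodType R) (f : U -> V -> T) (fb : is_bilinear f).

Lemma lift_tzero : tensor_lift f tzero = 0.
Proof. by rewrite tensor_lift_pi // /eval_sum big_nil. Qed.

Lemma lift_tadd x y :
  tensor_lift f (tadd x y) = tensor_lift f x + tensor_lift f y.
Proof. by rewrite tensor_lift_pi // /eval_sum big_cat. Qed.

Lemma lift_tscale a x : tensor_lift f (tscale a x) = a *: tensor_lift f x.
Proof.
rewrite tensor_lift_pi // /eval_sum big_map scaler_sumr.
apply: eq_bigr => z _ /=; have lf := fb.1 z.2.
have f0 : f 0 z.2 = 0.
  by have := lf (-1) 0 0; rewrite scaler0 addr0 scaleN1r addNr.
by have := lf a z.1 0; rewrite f0 !addr0.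
Qed.

Lemma lift_topp x : tensor_lift f (topp x) = - tensor_lift f x.
Proof. by rewrite lift_tscale scaleN1r. Qed.

End Lift.

Let liftE := (lift_tadd, lift_tscale, lift_topp, lift_tzero).

Fact taddA : associative tadd.
Proof. by move=> x y z; apply: tensor_ext => T f fb; rewrite !liftE ?addrA. Qed.

Fact taddC : commutative tadd.
Proof. by move=> x y; apply: tensor_ext => T f fb; rewrite !liftE // addrC. Qed.

Fact tadd0 : left_id tzero tadd.
Proof. by move=> x; apply: tensor_ext => T f fb; rewrite !liftE // add0r. Qed.

Fact taddN : left_inverse tzero topp tadd.
Proof. by move=> x; apply: tensor_ext => T f fb; rewrite !liftE // addNr. Qed.

HB.instance Definition _ :=
  GRing.isZmodule.Build tensor taddA taddC tadd0 taddN.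

Fact tscaleA a b x : tscale a (tscale b x) = tscale (a * b) x.
Proof. by apply: tensor_ext => T f fb; rewrite !liftE // scalerA. Qed.

Fact tscale1 : left_id 1 tscale.
Proof. by move=> x; apply: tensor_ext => T f fb; rewrite !liftE // scale1r. Qed.

Fact tscaleDr : right_distributive tscale +%R.
Proof.
by move=> a x y; apply: tensor_ext => T f fb; rewrite !liftE // scalerDr.
Qed.

Fact tscaleDl x : {morph tscale^~ x : a b / a + b}.
Proof.
by move=> a b; apply: tensor_ext => T f fb; rewrite !liftE // scalerDl.
Qed.

HB.instance Definition _ := GRing.Zmodule_isLmodule.Build R tensor
  tscaleA tscale1 tscaleDr tscaleDl.

Lemma tensor_lift_linear (T : lmodType R) (f : U -> V -> T) :
  is_bilinear f -> linear (tensor_lift f).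
Proof. by move=> fb a x y; rewrite lift_tadd // lift_tscale. Qed.

Lemma pure_bilinear : is_bilinear pure.
Proof.
split=> [v|u] a x y; apply: tensor_ext => T f fb;
  rewrite lift_tadd // lift_tscale // !tensor_lift_pure //.
  exact: fb.1.
exact: fb.2.
Qed.

Lemma tensor_sum_pure (t : tensor) : t = \sum_(x <- repr t) pure x.1 x.2.
Proof.
rewrite -[LHS]reprK; elim: (repr t) => [|x s IHs]; first by rewrite big_nil.
rewrite big_cons -IHs; apply: tensor_ext => T f fb.
rewrite lift_tadd // tensor_lift_pure // !tensor_lift_pi // /eval_sum.
by rewrite big_cons.
Qed.

Lemma tensor_lift_unique (T : lmodType R) (f : U -> V -> T)
    (h : {linear tensor -> T}) :
  is_bilinear f -> (forall u v, h (pure u v) = f u v) -> h =1 tensor_lift f.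
Proof.
move=> fb hf t; rewrite {1}[t]tensor_sum_pure linear_sum /=.
by apply: eq_bigr => x _; rewrite hf.
Qed.

(* f (x) g for endomorphisms f and g *)
Definition tensor_map (f : U -> U) (g : V -> V) : tensor -> tensor :=
  tensor_lift (fun u v => pure (f u) (g v)).

Lemma tensor_map_bilinear (f : U -> U) (g : V -> V) : linear f -> linear g ->
  is_bilinear (fun u v => pure (f u) (g v)).
Proof.
move=> lf lg; split=> [v|u] a x y.
  by rewrite lf; apply: pure_bilinear.1.
by rewrite lg; apply: pure_bilinear.2.
Qed.

End Tensor.

Section Ideals.
Variable k : comPzRingType.

Definition is_ideal (I : set k) : Prop :=
  [/\ I 0, forall x y, I x -> I y -> I (x + y) & forall a x, I x -> I (a * x)].

Definition is_max_ideal (p : set k) : Prop :=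
  [/\ is_ideal p, p <> setT
    & forall J : set k, is_ideal J -> (p `<=` J)%classic -> J = p \/ J = setT].

Record max_ideal := MaxIdeal { mideal :> set k; _ : is_max_ideal mideal }.

Lemma max_idealP (p : max_ideal) : is_max_ideal p. Proof. by case: p. Qed.

Lemma max_ideal1 (p : max_ideal) : ~ mideal p 1.
Proof.
have [[_ _ pM] pT _] := max_idealP p => p1; apply: pT.
by apply/seteqP; split=> // x _; rewrite -[x]mulr1; apply: pM.
Qed.

Lemma max_ideal_prime (p : max_ideal) (s t : k) :
  ~ mideal p s -> ~ mideal p t -> ~ mideal p (s * t).
Proof.
move=> ps pt; have [[p0 pD pM] pT pmax] := max_idealP p => pst.
pose J : set k := fun x => exists2 y, mideal p y & exists a, x = y + a * s.
have JI : is_ideal J.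
  split; first by exists 0 => //; exists 0; rewrite mul0r addr0.
    move=> _ _ [y py [a ->]] [z pz [b ->]]; exists (y + z); first exact: pD.
    by exists (a + b); rewrite mulrDl addrACA.
  move=> c _ [y py [a ->]]; exists (c * y); first exact: pM.
  by exists (c * a); rewrite mulrDr mulrA.
have [|Jp|JT] := pmax J JI.
- by move=> x px; exists x => //; exists 0; rewrite mul0r addr0.
- apply: ps; rewrite -Jp; exists 0 => //; exists 1.
  by rewrite mul1r add0r.
- have [y py [a e1]] : J 1 by rewrite JT.
  apply: pt; rewrite -[t]mul1r e1 mulrDl -mulrA; apply: pD; last exact: pM.
  by rewrite mulrC; apply: pM.
Qed.

End Ideals.

Section Localization.
Variables (k : comPzRingType) (p : max_ideal k).

Definition denom : Type := {s : k | s \notin (p : set k)}.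
HB.instance Definition _ := Choice.on denom.

Definition dval (s : denom) : k := sval s.

Lemma dvalP (s : denom) : ~ mideal p (dval s).
Proof. by have := svalP s; rewrite notin_setE. Qed.

Fact one_denom_subproof : 1 \notin (p : set k).
Proof. by rewrite notin_setE; apply: max_ideal1. Qed.

Fact mul_denom_subproof (s t : denom) : dval s * dval t \notin (p : set k).
Proof. by rewrite notin_setE; apply: max_ideal_prime; apply: dvalP. Qed.

Definition one_denom : denom := exist _ 1 one_denom_subproof.
Definition mul_denom (s t : denom) : denom :=
  exist _ (dval s * dval t) (mul_denom_subproof s t).

Lemma dval1 : dval one_denom = 1. Proof. by []. Qed.
Lemma dvalM s t : dval (mul_denom s t) = dval s * dval t. Proof. by []. Qed.
Let dvalE := (dval1, dvalM).

Definition loc_eqv (x y : k * denom) : bool :=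
  `[< exists u : denom,
        dval u * (x.1 * dval y.2) = dval u * (y.1 * dval x.2) >].

Fact loc_eqv_refl : reflexive loc_eqv.
Proof. by move=> x; apply/asboolP; exists one_denom. Qed.

Fact loc_eqv_sym : symmetric loc_eqv.
Proof.
by move=> x y; apply: asbool_equiv_eq; split=> -[u uxy]; exists u.
Qed.

Fact loc_eqv_trans : transitive loc_eqv.
Proof.
move=> [y t] [x s] [z r] /asboolP[u /= uE] /asboolP[v /= vE].
apply/asboolP; exists (mul_denom (mul_denom u v) t); rewrite !dvalE /=.
transitivity (dval v * dval r * (dval u * (x * dval t))); first by ring.
rewrite uE; transitivity (dval u * dval s * (dval v * (y * dval r))); first by ring.
by rewrite vE; ring.
Qed.

Canonical loc_equiv :=
  EquivRel loc_eqv loc_eqv_refl loc_eqv_sym loc_eqv_trans.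

Definition localization : Type := {eq_quot loc_eqv}.
HB.instance Definition _ := EqQuotient.on localization.
HB.instance Definition _ := Choice.on localization.

Definition frac (x : k) (s : denom) : localization := \pi_localization (x, s).

Lemma frac_eq x s y t : frac x s = frac y t <->
  exists u : denom, dval u * (x * dval t) = dval u * (y * dval s).
Proof. by split=> [/eqmodP/asboolP //|xy]; apply/eqmodP/asboolP. Qed.

Lemma fracP (a : localization) : exists x s, a = frac x s.
Proof.
by exists (repr a).1, (repr a).2; rewrite /frac -surjective_pairing reprK.
Qed.

Definition loc_add (a b : localization) : localization :=
  frac ((repr a).1 * dval (repr b).2 + (repr b).1 * dval (repr a).2)
       (mul_denom (repr a).2 (repr b).2).
Definition loc_opp (a : localization) : localization :=
  frac (- (repr a).1) (repr a).2.
Definition loc_mul (a b : localization) : localization :=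
  frac ((repr a).1 * (repr b).1) (mul_denom (repr a).2 (repr b).2).

Lemma repr_frac x s : exists u : denom,
  dval u * ((repr (frac x s)).1 * dval s) = dval u * (x * dval (repr (frac x s)).2).
Proof. by apply/frac_eq; rewrite /frac -surjective_pairing reprK. Qed.

Lemma loc_addE x s y t :
  loc_add (frac x s) (frac y t)
    = frac (x * dval t + y * dval s) (mul_denom s t).
Proof.
have [u] := repr_frac x s; have [v] := repr_frac y t; rewrite /loc_add.
case: (repr (frac x s)) (repr (frac y t)) => [x' s'] [y' t'] /= vE uE.
apply/frac_eq; exists (mul_denom u v); rewrite !dvalE.
transitivity (dval v * dval t * dval t' * (dval u * (x' * dval s))
  + dval u * dval s * dval s' * (dval v * (y' * dval t))); first by ring.
by rewrite uE vE; ring.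
Qed.

Lemma loc_mulE x s y t :
  loc_mul (frac x s) (frac y t) = frac (x * y) (mul_denom s t).
Proof.
have [u] := repr_frac x s; have [v] := repr_frac y t; rewrite /loc_mul.
case: (repr (frac x s)) (repr (frac y t)) => [x' s'] [y' t'] /= vE uE.
apply/frac_eq; exists (mul_denom u v); rewrite !dvalE.
transitivity ((dval u * (x' * dval s)) * (dval v * (y' * dval t))); first by ring.
by rewrite uE vE; ring.
Qed.

Lemma loc_oppE x s : loc_opp (frac x s) = frac (- x) s.
Proof.
have [u] := repr_frac x s; rewrite /loc_opp.
case: (repr (frac x s)) => [x' s'] /= uE.
by apply/frac_eq; exists u; rewrite !mulNr !mulrN uE.
Qed.

Lemma frac_eq1 x s y t : x * dval t = y * dval s -> frac x s = frac y t.
Proof. by move=> xy; apply/frac_eq; exists one_denom; rewrite xy. Qed.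

Let locE := (loc_addE, loc_mulE, loc_oppE).

Fact loc_addA : associative loc_add.
Proof.
move=> a b c.
have [x [s ->]] := fracP a; have [y [t ->]] := fracP b.
have [z [r ->]] := fracP c.
by rewrite !locE; apply: frac_eq1; rewrite !dvalE; ring.
Qed.

Fact loc_addC : commutative loc_add.
Proof.
move=> a b; have [x [s ->]] := fracP a; have [y [t ->]] := fracP b.
by rewrite !locE; apply: frac_eq1; rewrite !dvalE; ring.
Qed.

Fact loc_add0 : left_id (frac 0 one_denom) loc_add.
Proof.
move=> a; have [x [s ->]] := fracP a.
by rewrite !locE; apply: frac_eq1; rewrite !dvalE; ring.
Qed.

Fact loc_addN : left_inverse (frac 0 one_denom) loc_opp loc_add.
Proof.
move=> a; have [x [s ->]] := fracP a.
by rewrite !locE; apply: frac_eq1; rewrite !dvalE; ring.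
Qed.

HB.instance Definition _ :=
  GRing.isZmodule.Build localization loc_addA loc_addC loc_add0 loc_addN.

Fact loc_mulA : associative loc_mul.
Proof.
move=> a b c.
have [x [s ->]] := fracP a; have [y [t ->]] := fracP b.
have [z [r ->]] := fracP c.
by rewrite !locE; apply: frac_eq1; rewrite !dvalE; ring.
Qed.

Fact loc_mulC : commutative loc_mul.
Proof.
move=> a b; have [x [s ->]] := fracP a; have [y [t ->]] := fracP b.
by rewrite !locE; apply: frac_eq1; rewrite !dvalE; ring.
Qed.

Fact loc_mul1 : left_id (frac 1 one_denom) loc_mul.
Proof.
move=> a; have [x [s ->]] := fracP a.
by rewrite !locE; apply: frac_eq1; rewrite !dvalE; ring.
Qed.

Fact loc_mulDl : left_distributive loc_mul +%R.
Proof.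
move=> a b c.
have [x [s ->]] := fracP a; have [y [t ->]] := fracP b.
have [z [r ->]] := fracP c.
by rewrite /GRing.add /= !locE; apply: frac_eq1; rewrite !dvalE; ring.
Qed.

HB.instance Definition _ := GRing.Zmodule_isComPzRing.Build localization
  loc_mulA loc_mulC loc_mul1 loc_mulDl.

Lemma fracD x s y t :
  frac x s + frac y t = frac (x * dval t + y * dval s) (mul_denom s t).
Proof. exact: loc_addE. Qed.

Lemma fracN x s : - frac x s = frac (- x) s.
Proof. exact: loc_oppE. Qed.

Lemma fracM x s y t : frac x s * frac y t = frac (x * y) (mul_denom s t).
Proof. exact: loc_mulE. Qed.

Definition to_loc (x : k) : localization := frac x one_denom.

Fact to_loc_is_zmod_morphism : zmod_morphism to_loc.
Proof.
move=> x y; rewrite /to_loc fracN fracD.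
by apply: frac_eq1; rewrite !dvalE; ring.
Qed.

Fact to_loc_is_monoid_morphism : monoid_morphism to_loc.
Proof.
split=> // x y; rewrite /to_loc fracM.
by apply: frac_eq1; rewrite !dvalE; ring.
Qed.

HB.instance Definition _ := GRing.isZmodMorphism.Build k localization to_loc
  to_loc_is_zmod_morphism.
HB.instance Definition _ := GRing.isMonoidMorphism.Build k localization to_loc
  to_loc_is_monoid_morphism.

End Localization.

Section LocalizedModule.
Variables (k : comPzRingType) (gT : finGroupType) (p : max_ideal k).
Variable M : lmodType (group_algebra k gT).
Local Notation kp := (localization p).
Local Notation kpG := (group_algebra kp gT).
Local Notation U := (restrict (@to_loc k p) kp^o).
Local Notation V := (underlying M).

Definition localized_module : Type := tensor U V.
HB.instance Definition _ := GRing.Zmodule.on localized_module.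

Definition loc_act (c : kp) : U -> U := fun x => c * (x : kp).
Definition grp_act (g : gT) : V -> V := fun m => gbasis k g *: (m : M).

Fact loc_act_linear c : linear (loc_act c).
Proof.
by move=> a x y; rewrite /loc_act mulrDr; congr (_ + _); apply: mulrCA.
Qed.

Fact grp_act_linear g : linear (grp_act g).
Proof.
move=> a x y; rewrite /grp_act scalerDr; congr (_ + _).
change (gbasis k g *: (gconst gT a *: (x : M)) =
        gconst gT a *: (gbasis k g *: (x : M))).
by rewrite !scalerA gconst_basisC.
Qed.

(* The element c g of k_p G, for c in k_p and g in G, sends x (x) m to
   (c x) (x) (g m). *)
Definition kpG_scale (a : kpG) (t : localized_module) : localized_module :=
  \sum_(g : gT) tensor_map (loc_act (coef a g)) (grp_act g) t.

Let pureL (x : U) (m : V) : localized_module := pure x m.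

Let pureD x y m : pureL (x + y) m = pureL x m + pureL y m.
Proof.
by have := (pure_bilinear U V).1 m 1 x y; rewrite /= !scale1r.
Qed.

Let pure0 m : pureL 0 m = 0.
Proof. by apply: (addrI (pureL 0 m)); rewrite -pureD !addr0. Qed.

Let pure_suml (I : Type) (r : seq I) (F : I -> U) m :
  pureL (\sum_(i <- r) F i) m = \sum_(i <- r) pureL (F i) m.
Proof.
by elim/big_rec2: _ => [|i y1 y2 _ <-]; rewrite ?pure0 ?pureD.
Qed.

Let scale_pure a x m :
  kpG_scale a (pureL x m)
    = \sum_(g : gT) pureL (loc_act (coef a g) x) (grp_act g m).
Proof.
apply: eq_bigr => g _; rewrite /tensor_map tensor_lift_pure //.
by apply: tensor_map_bilinear; [apply: loc_act_linear|apply: grp_act_linear].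
Qed.

Fact kpG_scaleDr : right_distributive kpG_scale +%R.
Proof.
move=> a x y; rewrite -big_split /=; apply: eq_bigr => g _.
apply: lift_tadd; apply: tensor_map_bilinear.
  exact: loc_act_linear.
exact: grp_act_linear.
Qed.

Let scale_sum a (I : Type) (r : seq I) (F : I -> localized_module) :
  kpG_scale a (\sum_(i <- r) F i) = \sum_(i <- r) kpG_scale a (F i).
Proof.
elim/big_rec2: _ => [|i y1 y2 _ <-]; last by rewrite kpG_scaleDr.
by apply: (addrI (kpG_scale a 0)); rewrite -kpG_scaleDr !addr0.
Qed.

Let sum_pure (t : localized_module) :
  t = \sum_(x <- repr (t : tensor U V)) pureL x.1 x.2.
Proof. exact: tensor_sum_pure. Qed.

Fact kpG_scaleA a b t : kpG_scale a (kpG_scale b t) = kpG_scale (a * b) t.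
Proof.
rewrite [t]sum_pure !scale_sum; apply: eq_bigr => -[x m] _ /=.
rewrite !scale_pure scale_sum.
under eq_bigr do rewrite scale_pure.
rewrite exchange_big /=.
under [RHS]eq_bigr => g _.
  rewrite (_ : loc_act _ x = \sum_(h : gT)
    loc_act (coef a h) (loc_act (coef b (h^-1 * g)%g) x)); last first.
    rewrite /loc_act coefM mulr_suml; apply: eq_bigr => h _.
    by rewrite mulrA.
  rewrite pure_suml.
over.
rewrite [RHS]exchange_big /=; apply: eq_bigr => h _.
rewrite [RHS](reindex_inj (mulgI h)) /=; apply: eq_bigr => g _.
by rewrite mulKg; congr pureL; rewrite /grp_act scalerA gbasisM.
Qed.

Fact kpG_scale1 : left_id 1 kpG_scale.
Proof.
move=> t; rewrite [t]sum_pure !scale_sum; apply: eq_bigr => -[x m] _ /=.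
rewrite scale_pure (bigD1 1%g) //= big1 => [|g g1].
  rewrite addr0 -gbasis1 coef_gbasis eqxx; congr pureL.
    by rewrite /loc_act mul1r.
  by rewrite /grp_act gbasis1 scale1r.
rewrite -gbasis1 coef_gbasis (negPf g1) /loc_act mul0r.
exact: pure0.
Qed.

Fact kpG_scaleDl t : {morph kpG_scale^~ t : a b / a + b}.
Proof.
move=> a b; rewrite [t]sum_pure !scale_sum -big_split /=.
apply: eq_bigr => -[x m] _ /=; rewrite !scale_pure -big_split /=.
by apply: eq_bigr => g _; rewrite coefD /loc_act mulrDl pureD.
Qed.

HB.instance Definition _ := GRing.Zmodule_isLmodule.Build kpG localized_module
  kpG_scaleA kpG_scale1 kpG_scaleDr kpG_scaleDl.

Lemma scale_localized_pure (c : kp) (g : gT) (x : kp) (m : M) :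
  (gconst gT c * gbasis kp g) *: (pure (x : U) (m : V) : localized_module)
    = pure (c * x : U) (gbasis k g *: m : V).
Proof.
rewrite [LHS]scale_pure (bigD1 g) //= big1 => [|h hg].
  rewrite addr0; congr pureL; rewrite /loc_act coefM (bigD1 1%g) //=.
  rewrite big1 => [|h h1]; rewrite coef_gconst ?(negPf h1) ?mul0r //.
  by rewrite invg1 mul1g coef_gbasis !eqxx mulr1 addr0.
rewrite coefM big1 /loc_act ?mul0r => [|h' _].
  exact: pure0.
rewrite coef_gconst coef_gbasis; have [->|_] := eqVneq h' 1%g.
  by rewrite invg1 mul1g (negPf hg) mulr0.
by rewrite mul0r.
Qed.

End LocalizedModule.

(* Main.v *)
From HB Require Import structures.
From mathcomp Require Import all_boot all_fingroup all_algebra.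
From mathcomp Require Import generic_quotient ring.
From mathcomp Require Import boolp classical_sets.
Require Import Defs.

Set Implicit Arguments.
Unset Strict Implicit.
Unset Printing Implicit Defensive.

Import GRing.Theory.
Local Open Scope ring_scope.
Local Open Scope quotient_scope.

(* For a k-linear map t between kG-modules write Tr t = sum_g g t g^-1.  By
   Higman's criterion, P is weakly injective iff id_P = Tr t for some k-linear
   t : P -> P.  The criterion extends to cw-injectivity: M is cw-injective as
   soon as every kG-map f : F -> M from a finitely presented F is a trace
   ("M is traceable"), because f = Tr t factors as F -> Coind F -> M, so that
   the finitely presented weakly injective modules over M form a filtered
   category with colimit M.
   Localising a filtered colimit of weakly injectives gives one direction.
   Conversely, if M_p is cw-injective, then F -> M -> M_p lifts to a stage of the
   colimit and hence is a trace; clearing denominators in a finite presentation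
   of F, s f is a trace into M for some s outside p.  The s in k for which s f is
   a trace form an ideal, contained in no maximal ideal, so f is a trace. *)

Lemma exists_linear (R : pzRingType) (U V : lmodType R) (f : U -> V) :
  linear f -> exists g : {linear U -> V}, g =1 f.
Proof.
move=> fL; pose F := GRing.isLinear.Build R U V *:%R f fL.
pose g : {linear U -> V} := HB.pack f F.
by exists g.
Qed.

(** * Quotient modules *)

Section QuotientModule.
Variables (R : pzRingType) (V : lmodType R).

Record submodule := Submodule {
  smem :> V -> Prop;
  smem0 : smem 0;
  smemP : forall a x y, smem x -> smem y -> smem (a *: x + y)
}.

Variable K : submodule.

Lemma smemD x y : K x -> K y -> K (x + y).
Proof. by move=> Kx Ky; rewrite -[x]scale1r; apply: smemP. Qed.

Lemma smemZ a x : K x -> K (a *: x).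
Proof. by move=> Kx; rewrite -[_ *: _]addr0; apply: smemP => //; apply: smem0. Qed.

Lemma smemN x : K x -> K (- x).
Proof. by rewrite -scaleN1r; apply: smemZ. Qed.

Definition congruent (x y : V) : bool := `[< K (x - y) >].

Fact congruent_refl : reflexive congruent.
Proof. by move=> x; apply/asboolP; rewrite subrr; apply: smem0. Qed.

Fact congruent_sym : symmetric congruent.
Proof.
by move=> x y; apply: asbool_equiv_eq; split=> /smemN; rewrite opprB.
Qed.

Fact congruent_trans : transitive congruent.
Proof.
move=> y x z /asboolP xy /asboolP yz; apply/asboolP.
by rewrite -[x](subrK y) -addrA; apply: smemD.
Qed.

Canonical congruent_equiv :=
  EquivRel congruent congruent_refl congruent_sym congruent_trans.

Definition quotmod : Type := {eq_quot congruent}.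
HB.instance Definition _ := EqQuotient.on quotmod.
HB.instance Definition _ := Choice.on quotmod.

Definition qproj (x : V) : quotmod := \pi_quotmod x.

Lemma qproj_eq x y : qproj x = qproj y <-> K (x - y).
Proof. by split=> [/eqmodP/asboolP //|xy]; apply/eqmodP/asboolP. Qed.

Lemma qproj_repr a : qproj (repr a) = a. Proof. exact: reprK. Qed.

Lemma qproj_surj a : exists x, a = qproj x.
Proof. by exists (repr a); rewrite qproj_repr. Qed.

Let repr_qproj x : K (repr (qproj x) - x).
Proof. by apply/qproj_eq; rewrite qproj_repr. Qed.

Definition qadd (a b : quotmod) := qproj (repr a + repr b).
Definition qopp (a : quotmod) := qproj (- repr a).
Definition qscale (r : R) (a : quotmod) := qproj (r *: repr a).

Let qaddE x y : qadd (qproj x) (qproj y) = qproj (x + y).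
Proof. by apply/qproj_eq; rewrite opprD addrACA; apply: smemD. Qed.

Let qoppE x : qopp (qproj x) = qproj (- x).
Proof. by apply/qproj_eq; rewrite -opprD; apply: smemN. Qed.

Let qscaleE r x : qscale r (qproj x) = qproj (r *: x).
Proof. by apply/qproj_eq; rewrite -scalerBr; apply: smemZ. Qed.

Let qE := (qaddE, qoppE, qscaleE).

Fact qaddA : associative qadd.
Proof.
move=> a b c; case: (qproj_surj a) (qproj_surj b) (qproj_surj c).
by move=> x -> [y ->] [z ->]; rewrite !qE addrA.
Qed.

Fact qaddC : commutative qadd.
Proof.
by move=> a b; case: (qproj_surj a) (qproj_surj b) => x -> [y ->]; rewrite !qE addrC.
Qed.

Fact qadd0 : left_id (qproj 0) qadd.
Proof. by move=> a; case: (qproj_surj a) => x ->; rewrite !qE add0r. Qed.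

Fact qaddN : left_inverse (qproj 0) qopp qadd.
Proof. by move=> a; case: (qproj_surj a) => x ->; rewrite !qE addNr. Qed.

HB.instance Definition _ := GRing.isZmodule.Build quotmod qaddA qaddC qadd0 qaddN.

Fact qscaleA r s a : qscale r (qscale s a) = qscale (r * s) a.
Proof. by case: (qproj_surj a) => x ->; rewrite !qE scalerA. Qed.

Fact qscale1 : left_id 1 qscale.
Proof. by move=> a; case: (qproj_surj a) => x ->; rewrite !qE scale1r. Qed.

Fact qscaleDr : right_distributive qscale +%R.
Proof.
move=> r a b; case: (qproj_surj a) (qproj_surj b) => x -> [y ->].
by rewrite /GRing.add /= !qE scalerDr.
Qed.

Fact qscaleDl a : {morph qscale^~ a : r s / r + s}.
Proof.
by case: (qproj_surj a) => x -> r s; rewrite /GRing.add /= !qE scalerDl.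
Qed.

HB.instance Definition _ := GRing.Zmodule_isLmodule.Build R quotmod
  qscaleA qscale1 qscaleDr qscaleDl.

Fact qproj_is_linear : linear qproj.
Proof. by move=> r x y; rewrite -qaddE -qscaleE. Qed.

HB.instance Definition _ := GRing.isLinear.Build R V quotmod *:%R qproj
  qproj_is_linear.

Lemma qproj_eq0 x : qproj x = 0 <-> K x.
Proof. by rewrite -(linear0 qproj) qproj_eq subr0. Qed.

Lemma quot_lift (W : lmodType R) (f : {linear V -> W}) :
  (forall x, K x -> f x = 0) ->
  exists g : {linear quotmod -> W}, forall x, g (qproj x) = f x.
Proof.
move=> fK; have wd x : f (repr (qproj x)) = f x.
  by apply/eqP; rewrite -subr_eq0 -linearB fK.
have [|g gE] := @exists_linear R quotmod W (fun a => f (repr a)).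
  move=> r a b; case: (qproj_surj a) (qproj_surj b) => x -> [y ->].
  by rewrite -linearP !wd linearP.
by exists g => x; rewrite gE wd.
Qed.

End QuotientModule.

(** * Filtered colimits *)

Section FilteredColimit.
Variables (I : category) (R : pzRingType) (D : diagram I R).
Hypothesis If : filtered I.

Lemma filtered_object : exists i : I, True.
Proof. by case: If => -[i]; exists i. Qed.

Lemma filtered_cospan (i j : I) :
  exists (l : I) (_ : Defs.hom i l) (_ : Defs.hom j l), True.
Proof. by have [_ /(_ i j)[l [[u] [v]]] _] := If; exists l, u, v. Qed.

Lemma filtered_square (i j l : I) (u : Defs.hom i j) (v : Defs.hom i l) :
  exists (m : I) (u' : Defs.hom j m) (v' : Defs.hom l m), hcomp u' u = hcomp v' v.
Proof.
have [m [a [b _]]] := filtered_cospan j l.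
have [_ _ /(_ _ _ (hcomp a u) (hcomp b v))[n [w ww]]] := If.
by exists n, (hcomp w a), (hcomp w b); rewrite -!hcompA.
Qed.

(** Induction on the enumeration of [T]: a cospan joins the stage reached so far to the one for the
    new index. It brings the images of finitely many generators to one stage. *)
Lemma filtered_bound (T : finType) (P : T -> I -> Prop) :
  (forall a i j, Defs.hom i j -> P a i -> P a j) ->
  (forall a, exists i, P a i) -> exists i, forall a, P a i.
Proof.
move=> Pup Pex; suff [i iP] : exists i, forall a, a \in enum T -> P a i.
  by exists i => a; apply: iP; rewrite mem_enum.
elim: (enum T) => [|a s [i iP]]; first by have [i _] := filtered_object; exists i.
have [j jP] := Pex a; have [l [u [v _]]] := filtered_cospan i j.
by exists l => b; rewrite inE => /predU1P[->|/iP]; [apply: Pup jP | apply: Pup].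
Qed.

(** The conditions concern an arrow out of [i], so at each induction step two such arrows are
    completed to a commuting square. Used to impose finitely many equations at a later stage. *)
Lemma filtered_refine (T : finType) (i : I) (P : T -> forall j, Defs.hom i j -> Prop) :
  (forall a j l (u : Defs.hom i j) (v : Defs.hom j l), P a j u -> P a l (hcomp v u)) ->
  (forall a, exists j (u : Defs.hom i j), P a j u) ->
  exists j (u : Defs.hom i j), forall a, P a j u.
Proof.
move=> Pup Pex.
suff [j [u uP]] : exists j (u : Defs.hom i j), forall a, a \in enum T -> P a j u.
  by exists j, u => a; apply: uP; rewrite mem_enum.
elim: (enum T) => [|a s [j [u uP]]]; first by exists i, (Defs.idm i).
have [j' [u' u'P]] := Pex a; have [l [v [v' vv']]] := filtered_square u u'.
exists l, (hcomp v u) => b; rewrite inE => /predU1P[->|/uP]; last exact: Pup.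
by rewrite vv'; apply: Pup.
Qed.

(** The quotient needs a choice type while [I] is an arbitrary type, so equality and choice are
    classical. *)
Definition germ : Type := {i : I & D i}.
HB.instance Definition _ := gen_eqMixin germ.
HB.instance Definition _ := gen_choiceMixin germ.

Definition germ_eqv (x y : germ) : bool :=
  `[< exists (l : I) (u : Defs.hom (tag x) l) (v : Defs.hom (tag y) l),
        dmap D u (tagged x) = dmap D v (tagged y) >].

Fact germ_eqv_refl : reflexive germ_eqv.
Proof. by move=> x; apply/asboolP; exists (tag x), (Defs.idm _), (Defs.idm _). Qed.

Fact germ_eqv_sym : symmetric germ_eqv.
Proof.
by move=> x y; apply: asbool_equiv_eq; split=> -[l [u [v uv]]]; exists l, v, u.
Qed.

Fact germ_eqv_trans : transitive germ_eqv.
Proof.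
move=> [j y] [i x] [l z] /asboolP[/= a [u [v uv]]] /asboolP[/= b [s [t st]]].
apply/asboolP; have [c [f [g fg]]] := filtered_square v s.
exists c, (hcomp f u), (hcomp g t).
by rewrite !dmap_comp /= uv -st -[LHS]dmap_comp fg dmap_comp.
Qed.

Canonical germ_equiv :=
  EquivRel germ_eqv germ_eqv_refl germ_eqv_sym germ_eqv_trans.

Definition fcolim : Type := {eq_quot germ_eqv}.
HB.instance Definition _ := EqQuotient.on fcolim.
HB.instance Definition _ := Choice.on fcolim.

Definition ginj (i : I) (x : D i) : fcolim := \pi_fcolim (existT (fun i => D i : Type) i x).

Lemma ginj_eq i j (x : D i) (y : D j) : ginj x = ginj y <->
  exists (l : I) (u : Defs.hom i l) (v : Defs.hom j l), dmap D u x = dmap D v y.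
Proof. by split=> [/eqmodP/asboolP //|xy]; apply/eqmodP/asboolP. Qed.

Lemma ginj_map i j (u : Defs.hom i j) (x : D i) : ginj (dmap D u x) = ginj x.
Proof. by apply/ginj_eq; exists j, (Defs.idm j), u; rewrite dmap_id. Qed.

Lemma ginj_surj (a : fcolim) : exists i (x : D i), a = ginj x.
Proof.
by rewrite -[a]reprK; case: (repr a) => i x; exists i, x.
Qed.

Lemma ginj_surj2 (a b : fcolim) : exists i (x y : D i), a = ginj x /\ b = ginj y.
Proof.
have [i [x ->]] := ginj_surj a; have [j [y ->]] := ginj_surj b.
have [l [u [v _]]] := filtered_cospan i j.
by exists l, (dmap D u x), (dmap D v y); rewrite !ginj_map.
Qed.

Lemma ginj_surj3 (a b c : fcolim) :
  exists i (x y z : D i), [/\ a = ginj x, b = ginj y & c = ginj z].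
Proof.
have [i [x [y [-> ->]]]] := ginj_surj2 a b; have [j [z ->]] := ginj_surj c.
have [l [u [v _]]] := filtered_cospan i j.
by exists l, (dmap D u x), (dmap D u y), (dmap D v z); rewrite !ginj_map.
Qed.

(** Addition happens at a chosen stage carrying representatives of both classes; [caddE] shows that
    the choice does not matter. *)
Definition cadd (a b : fcolim) : fcolim :=
  let i := cid (ginj_surj2 a b) in let x := cid (projT2 i) in
  ginj (projT1 x + projT1 (cid (projT2 x))).

Let cadd_ex a b : exists i (x y : D i),
  [/\ a = ginj x, b = ginj y & cadd a b = ginj (x + y)].
Proof.
rewrite /cadd; case: (cid _) => i /= ixy; case: (cid _) => x /= xy.
by case: (cid _) => y /= [-> ->]; exists i, x, y.
Qed.

Let caddE i (x y : D i) : cadd (ginj x) (ginj y) = ginj (x + y).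
Proof.
have [j [x' [y' [/ginj_eq[a [u [v uv]]] /ginj_eq[b [s [t st]]] ->]]]] :=
  cadd_ex (ginj x) (ginj y).
(* The square makes the arrows out of [i] agree; it leaves two arrows out of [j], one per summand,
   which [w] equalises. *)
have [l [f [g fg]]] := filtered_square u s.
have [_ _ /(_ _ _ (hcomp f v) (hcomp g t))[m [w ww]]] := If.
apply/ginj_eq; exists m, (hcomp w (hcomp f v)), (hcomp w (hcomp f u)).
rewrite !linearD; congr (_ + _).
  by rewrite !dmap_comp /= !dmap_comp /= uv.
by rewrite fg ww !dmap_comp /= !dmap_comp /= st.
Qed.

Definition czero : fcolim :=
  ginj (0 : D (projT1 (cid filtered_object))).

Let czeroE i : czero = ginj (0 : D i).
Proof.
rewrite /czero; move: (projT1 _) => j; have [l [u [v _]]] := filtered_cospan i j.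
by apply/ginj_eq; exists l, v, u; rewrite !linear0.
Qed.

Definition cscale (r : R) (a : fcolim) : fcolim := ginj (r *: tagged (repr a)).

Let cscaleE r i (x : D i) : cscale r (ginj x) = ginj (r *: x).
Proof.
have : ginj (tagged (repr (ginj x))) = ginj x.
  by rewrite -[RHS]reprK; case: (repr _).
rewrite /cscale => /ginj_eq[l [u [v uv]]].
by apply/ginj_eq; exists l, u, v; rewrite !linearZ /= uv.
Qed.

Let cE := (caddE, cscaleE).

Fact caddA : associative cadd.
Proof.
by move=> a b c; have [i [x [y [z [-> -> ->]]]]] := ginj_surj3 a b c;
  rewrite !cE addrA.
Qed.

Fact caddC : commutative cadd.
Proof.
by move=> a b; have [i [x [y [-> ->]]]] := ginj_surj2 a b; rewrite !cE addrC.
Qed.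

Fact cadd0 : left_id czero cadd.
Proof.
by move=> a; have [i [x ->]] := ginj_surj a; rewrite (czeroE i) !cE add0r.
Qed.

Fact caddN : left_inverse czero (cscale (-1)) cadd.
Proof.
move=> a; have [i [x ->]] := ginj_surj a.
by rewrite (czeroE i) !cE scaleN1r addNr.
Qed.

HB.instance Definition _ := GRing.isZmodule.Build fcolim caddA caddC cadd0 caddN.

Fact cscaleA r s a : cscale r (cscale s a) = cscale (r * s) a.
Proof. by have [i [x ->]] := ginj_surj a; rewrite !cE scalerA. Qed.

Fact cscale1 : left_id 1 cscale.
Proof. by move=> a; have [i [x ->]] := ginj_surj a; rewrite !cE scale1r. Qed.

Fact cscaleDr : right_distributive cscale +%R.
Proof.
move=> r a b; have [i [x [y [-> ->]]]] := ginj_surj2 a b.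
by rewrite /GRing.add /= !cE scalerDr.
Qed.

Fact cscaleDl a : {morph cscale^~ a : r s / r + s}.
Proof.
by have [i [x ->]] := ginj_surj a => r s; rewrite /GRing.add /= !cE scalerDl.
Qed.

HB.instance Definition _ := GRing.Zmodule_isLmodule.Build R fcolim
  cscaleA cscale1 cscaleDr cscaleDl.

Fact ginj_is_linear i : linear (@ginj i).
Proof. by move=> r x y; rewrite -caddE -cscaleE. Qed.

HB.instance Definition _ i := GRing.isLinear.Build R (D i) fcolim *:%R (@ginj i)
  (@ginj_is_linear i).

Lemma ginj_eq0 i (x : D i) : ginj x = 0 ->
  exists j (u : Defs.hom i j), dmap D u x = 0.
Proof.
rewrite -(linear0 (@ginj i)) => /ginj_eq[l [u [v]]].
by rewrite linear0; exists l, u.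
Qed.

Lemma ginj_cocone : is_cocone (fun i => @ginj i : {linear D i -> fcolim}).
Proof. by move=> i j u x; apply: ginj_map. Qed.

Definition jointly_surjective (L : lmodType R) (c : forall i, {linear D i -> L}) :=
  forall y, exists i (x : D i), y = c i x.

Definition kernels_die (L : lmodType R) (c : forall i, {linear D i -> L}) :=
  forall i (x : D i), c i x = 0 -> exists j (u : Defs.hom i j), dmap D u x = 0.

(** Every element of [L] is some [c i x], and by [ck] two such values agree only if the elements
    merge at a later stage, where a cocone [d] cannot separate them. Hence [d i x] depends on
    [c i x] alone. *)
Lemma is_colimit_filtered (L : lmodType R) (c : forall i, {linear D i -> L}) :
  is_cocone c -> jointly_surjective c -> kernels_die c -> is_colimit c.
Proof.
move=> cc cs ck; split=> // N d dc.
have wd i (x : D i) j (y : D j) : c i x = c j y -> d i x = d j y.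
  have [l [u [v _]]] := filtered_cospan i j.
  rewrite -(cc _ _ u) -(cc _ _ v) -(dc _ _ u) -(dc _ _ v) /= => /eqP.
  rewrite -subr_eq0 -linearB => /eqP/ck[m [w]].
  rewrite linearB => /eqP; rewrite subr_eq0 => /eqP ww.
  by rewrite -(dc _ _ w) /= ww; apply: dc.
have /choice[U UE] : forall y, exists z, forall i x, y = c i x -> z = d i x.
  move=> y; have [i [x yE]] := cs y.
  by exists (d i x) => j x' yE'; apply: wd; rewrite -yE.
have [|u uE] := @exists_linear R L N U.
  move=> r y z; have [i [x yE]] := cs y; have [j [x' zE]] := cs z.
  have [l [v [w _]]] := filtered_cospan i j.
  rewrite -(cc _ _ v) in yE; rewrite -(cc _ _ w) in zE.
  rewrite (UE _ _ _ yE) (UE _ _ _ zE) -linearP; apply: UE.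
  by rewrite linearP yE zE.
exists u; split=> [i x | u' u'E y]; first by rewrite /= uE; apply: UE.
by have [i [x ->]] := cs y; rewrite uE (UE _ i x) // -u'E.
Qed.

(** The union [K] of the images is a submodule. The projection of [L] modulo [K] and the zero map
    induce the same cocone, so uniqueness in the universal property makes them equal. *)
Lemma colimit_jointly_surjective (L : lmodType R) (c : forall i, {linear D i -> L}) :
  is_colimit c -> jointly_surjective c.
Proof.
move=> [cc cu]; have [i0] : inhabited I by case: If.
have K0 : exists i (x : D i), 0 = c i x by exists i0, 0; rewrite linear0.
have KP a y z : (exists i (x : D i), y = c i x) -> (exists i (x : D i), z = c i x) ->
    exists i (x : D i), a *: y + z = c i x.
  move=> [i [x ->]] [j [x' ->]]; have [l [v [w _]]] := filtered_cospan i j.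
  by exists l, (a *: dmap D v x + dmap D w x');
    rewrite linearP -(cc _ _ v) -(cc _ _ w).
pose K := Submodule K0 KP.
have [|u [_ uq]] := cu (quotmod K) (fun i => qproj K \o c i : {linear _ -> _}).
  by move=> i j u x; congr (qproj _); apply: cc.
move=> y; apply/(qproj_eq0 K); transitivity (u y).
  exact: (uq (qproj K)).
symmetry; apply: (uq \0%R) => i x /=; symmetry; apply/(qproj_eq0 K).
by exists i, x.
Qed.

(** The universal property maps [L] to the explicit model [fcolim], where an element vanishes only
    if it already does at some stage. *)
Lemma colimit_kernels_die (L : lmodType R) (c : forall i, {linear D i -> L}) :
  is_colimit c -> kernels_die c.
Proof.
move=> [_ cu] i x cx0; have [u [uE _]] := cu _ _ ginj_cocone.
by apply: ginj_eq0; rewrite -[LHS]uE /= cx0 linear0.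
Qed.

End FilteredColimit.

(** * Traces of k-linear maps *)

Section KLinear.
Variables (k : comPzRingType) (gT : finGroupType).
Local Notation kG := (group_algebra k gT).
Local Notation "c %:C" := (gconst gT c) (at level 2, left associativity, format "c %:C").
Local Notation "''b_' g" := (gbasis k g) (at level 8, g at level 2, format "''b_' g").

Lemma coef_sum (J : Type) (r : seq J) (F : J -> kG) g :
  coef (\sum_(j <- r) F j) g = \sum_(j <- r) coef (F j) g.
Proof.
by elim/big_rec2: _ => [|j y z _ <-]; rewrite ?coefD // /coef ffunE.
Qed.

Lemma group_algebra_sum (a : kG) : a = \sum_(g : gT) (coef a g)%:C * 'b_g.
Proof.
apply: coef_inj => h; rewrite coef_sum (bigD1 h) //= big1 => [|g gh].
  rewrite addr0 coefM (bigD1 1%g) //= big1 => [|x x1].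
    by rewrite addr0 coef_gconst coef_gbasis invg1 mul1g !eqxx mulr1.
  by rewrite coef_gconst (negPf x1) mul0r.
rewrite coefM big1 // => x _; rewrite coef_gconst coef_gbasis.
have [->|_] := eqVneq x 1%g; last by rewrite mul0r.
by rewrite invg1 mul1g eq_sym (negPf gh) mulr0.
Qed.

Section Maps.
Variables A B : lmodType kG.

(** Phrased with the scalars [c%:C] of [kG], so that these maps compose with [kG]-linear ones
    without passing to underlying modules. *)
Definition klinear (f : A -> B) : Prop :=
  forall (c : k) x y, f (c%:C *: x + y) = c%:C *: f x + f y.

Variables (f : A -> B) (fk : klinear f).

Lemma klinearD x y : f (x + y) = f x + f y.
Proof. by rewrite -[x]scale1r -(rmorph1 (gconst gT)) fk rmorph1 !scale1r. Qed.

Lemma klinear0 : f 0 = 0.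
Proof. by apply: (addrI (f 0)); rewrite -klinearD !addr0. Qed.

Lemma klinearZ c x : f (c%:C *: x) = c%:C *: f x.
Proof. by rewrite -[_ *: x]addr0 fk klinear0 addr0. Qed.

Lemma klinear_sum (J : Type) (r : seq J) (F : J -> A) :
  f (\sum_(j <- r) F j) = \sum_(j <- r) f (F j).
Proof. by apply: big_morph; [apply: klinearD | apply: klinear0]. Qed.

Lemma klinear_equivariant : (forall g x, f ('b_g *: x) = 'b_g *: f x) -> linear f.
Proof.
move=> fG a x y; rewrite klinearD; congr (_ + _).
rewrite [a]group_algebra_sum !scaler_suml klinear_sum.
by apply: eq_bigr => g _; rewrite -!scalerA klinearZ fG.
Qed.

Definition trace (x : A) : B := \sum_(g : gT) 'b_g *: f ('b_(g^-1) *: x).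

End Maps.

Lemma trace_linear (A B : lmodType kG) (f : A -> B) : klinear f -> linear (trace f).
Proof.
move=> fk; apply: klinear_equivariant => [|h x]; rewrite /trace.
  move=> c x y; rewrite scaler_sumr -big_split; apply: eq_bigr => g _ /=.
  by rewrite scalerDr scalerA -gconst_basisC -scalerA fk scalerDr !scalerA gconst_basisC.
rewrite scaler_sumr (reindex_inj (mulgI h)) /=; apply: eq_bigr => g _.
by rewrite !scalerA -!gbasisM invMg mulgKV.
Qed.

Lemma linear_klinear (A B : lmodType kG) (f : {linear A -> B}) : klinear f.
Proof. by move=> c x y; apply: linearP. Qed.

Lemma klinear_comp (A B C : lmodType kG) (f : B -> C) (g : A -> B) :
  klinear f -> klinear g -> klinear (f \o g).
Proof. by move=> fk gk c x y; rewrite /= gk fk. Qed.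

Lemma klinear_scale (A B : lmodType kG) (f : A -> B) c :
  klinear f -> klinear (fun x => c%:C *: f x).
Proof.
move=> fk d x y; rewrite fk scalerDr !scalerA.
by rewrite -!(rmorphM (gconst gT)) [c * d]mulrC.
Qed.

(** A [kG]-map commutes with group elements and so slides out of the sum. Together with
    [trace_compr] this makes the traces stable under composition with [kG]-maps on either side. *)
Lemma trace_compl (A B C : lmodType kG) (h : {linear B -> C}) (f : A -> B) x :
  trace (h \o f) x = h (trace f x).
Proof.
rewrite /trace linear_sum; apply: eq_bigr => g _ /=.
by rewrite linearZ.
Qed.

Lemma trace_compr (A B C : lmodType kG) (f : B -> C) (h : {linear A -> B}) x :
  trace (f \o h) x = trace f (h x).
Proof. by apply: eq_bigr => g _ /=; rewrite linearZ. Qed.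

Lemma trace_scale (A B : lmodType kG) (f : A -> B) c x :
  trace (fun y => c%:C *: f y) x = c%:C *: trace f x.
Proof.
rewrite /trace scaler_sumr; apply: eq_bigr => g _.
by rewrite !scalerA gconst_basisC.
Qed.

End KLinear.

(** * Coinduced modules *)

Section Coinduced.
Variables (k : comPzRingType) (gT : finGroupType).
Local Notation kG := (group_algebra k gT).
Local Notation "c %:C" := (gconst gT c) (at level 2, left associativity, format "c %:C").
Local Notation "''b_' g" := (gbasis k g) (at level 8, g at level 2, format "''b_' g").
Variable P : lmodType kG.

(** This is Hom_k(kG, P), with [G] acting by right translation of the argument; the action of [G] on
    [P] enters only through [coind_unit]. *)
Definition coind : Type := {ffun gT -> P}.
HB.instance Definition _ := GRing.Zmodule.copy coind {ffun gT -> P}.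

Definition coev (x : coind) (g : gT) : P := (x : {ffun gT -> P}) g.

Lemma coev_inj x y : coev x =1 coev y -> x = y.
Proof. by move=> xy; apply/ffunP. Qed.

Lemma coevD x y g : coev (x + y) g = coev x g + coev y g.
Proof. by rewrite /coev ffunE. Qed.

Lemma coev_sum (J : Type) (r : seq J) (F : J -> coind) g :
  coev (\sum_(j <- r) F j) g = \sum_(j <- r) coev (F j) g.
Proof.
by elim/big_rec2: _ => [|j y z _ <-]; rewrite ?coevD // /coev ffunE.
Qed.

Definition coind_scale (a : kG) (x : coind) : coind :=
  [ffun h => \sum_(g : gT) (coef a g)%:C *: coev x (h * g)%g].

Lemma coev_scale a x h :
  coev (coind_scale a x) h = \sum_(g : gT) (coef a g)%:C *: coev x (h * g)%g.
Proof. by rewrite /coev ffunE. Qed.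

Fact coind_scaleA a b x :
  coind_scale a (coind_scale b x) = coind_scale (a * b) x.
Proof.
apply: coev_inj => h; rewrite !coev_scale.
under eq_bigr do rewrite coev_scale scaler_sumr.
under [RHS]eq_bigr do rewrite coefM rmorph_sum scaler_suml.
rewrite [RHS]exchange_big /=; apply: eq_bigr => g _.
rewrite [RHS](reindex_inj (mulgI g)) /=; apply: eq_bigr => y _.
by rewrite mulKg rmorphM scalerA mulgA.
Qed.

Fact coind_scale1 : left_id 1 coind_scale.
Proof.
move=> x; apply: coev_inj => h; rewrite coev_scale (bigD1 1%g) //= big1 => [|g g1].
  by rewrite -gbasis1 coef_gbasis eqxx rmorph1 scale1r mulg1 addr0.
by rewrite -gbasis1 coef_gbasis (negPf g1) rmorph0 scale0r.
Qed.

Fact coind_scaleDr : right_distributive coind_scale +%R.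
Proof.
move=> a x y; apply: coev_inj => h; rewrite coevD !coev_scale -big_split.
by apply: eq_bigr => g _; rewrite coevD scalerDr.
Qed.

Fact coind_scaleDl x : {morph coind_scale^~ x : a b / a + b}.
Proof.
move=> a b; apply: coev_inj => h; rewrite coevD !coev_scale -big_split.
by apply: eq_bigr => g _; rewrite coefD rmorphD scalerDl.
Qed.

HB.instance Definition _ := GRing.Zmodule_isLmodule.Build kG coind
  coind_scaleA coind_scale1 coind_scaleDr coind_scaleDl.

Lemma coev_basis g x h : coev ('b_g *: x) h = coev x (h * g)%g.
Proof.
rewrite coev_scale (bigD1 g) //= big1 => [|y yg].
  by rewrite coef_gbasis eqxx rmorph1 scale1r addr0.
by rewrite coef_gbasis (negPf yg) rmorph0 scale0r.
Qed.

Lemma coev_const c x h : coev (c%:C *: x) h = c%:C *: coev x h.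
Proof.
rewrite coev_scale (bigD1 1%g) //= big1 => [|y y1].
  by rewrite coef_gconst eqxx mulg1 addr0.
by rewrite coef_gconst (negPf y1) rmorph0 scale0r.
Qed.

Lemma coev_klin c x y h : coev (c%:C *: x + y) h = c%:C *: coev x h + coev y h.
Proof. by rewrite coevD coev_const. Qed.

Definition cofun (f : gT -> P) : coind := [ffun g => f g].

Lemma coev_cofun f g : coev (cofun f) g = f g.
Proof. by rewrite /coev ffunE. Qed.

(** Unit of the adjunction between restriction and coinduction; evaluation at 1 is a k-linear
    retraction of it. *)
Definition coind_unit (x : P) : coind := cofun (fun g => 'b_g *: x).

Fact coind_unit_is_linear : linear coind_unit.
Proof.
apply: klinear_equivariant => [c x y|g x]; apply: coev_inj => h.
  rewrite coev_klin !coev_cofun scalerDr !scalerA.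
  by rewrite gconst_basisC.
by rewrite coev_basis !coev_cofun scalerA gbasisM.
Qed.

HB.instance Definition _ := GRing.isLinear.Build kG P coind *:%R coind_unit
  coind_unit_is_linear.

Definition codelta (g : gT) (x : P) : coind := cofun (fun h => if h == g then x else 0).

Lemma codelta_klinear_subproof g c x y :
  codelta g (c%:C *: x + y) = c%:C *: codelta g x + codelta g y.
Proof.
apply: coev_inj => h; rewrite coev_klin !coev_cofun.
by case: eqP; rewrite // scaler0 addr0.
Qed.

Lemma basis_codelta g h x : 'b_g *: codelta h x = codelta (h * g^-1) x.
Proof.
apply: coev_inj => y; rewrite coev_basis !coev_cofun.
by rewrite -(can2_eq (mulgK g) (mulgKV g)).
Qed.

Lemma coind_sum x : x = \sum_(g : gT) codelta g (coev x g).
Proof.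
apply: coev_inj => h; rewrite coev_sum (bigD1 h) //= big1 => [|g gh].
  by rewrite coev_cofun eqxx addr0.
by rewrite coev_cofun eq_sym (negPf gh).
Qed.

End Coinduced.

(** * Higman's criterion *)

Section Higman.
Variables (k : comPzRingType) (gT : finGroupType).
Local Notation kG := (group_algebra k gT).
Local Notation "c %:C" := (gconst gT c) (at level 2, left associativity, format "c %:C").
Local Notation "''b_' g" := (gbasis k g) (at level 8, g at level 2, format "''b_' g").

Definition higman (P : lmodType kG) : Prop :=
  exists2 t : P -> P, klinear t & trace t =1 id.

Lemma codelta_klinear (P : lmodType kG) (g : gT) : klinear (@codelta k gT P g).
Proof. by move=> c x y; apply: codelta_klinear_subproof. Qed.

(** The embedding of [P] in [coind P] splits over [k], so weak injectivity gives a [kG]-linear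
    retraction [r]. The map sending x to [r] of the function with value x at 1 and 0 elsewhere then
    has trace the identity. *)
Lemma weakly_injective_higman (P : lmodType kG) : weakly_injective P -> higman P.
Proof.
move=> Pwi; pose e : {linear P -> coind P} := @coind_unit k gT P.
have e1 x : coev (e x) 1%g = x by rewrite coev_cofun gbasis1 scale1r.
have K0 : exists x, 0 = e x by exists 0; rewrite linear0.
have KP a y z : (exists x, y = e x) -> (exists x, z = e x) -> exists x, a *: y + z = e x.
  by move=> [x ->] [x' ->]; exists (a *: x + x'); rewrite linearP.
pose K := Submodule K0 KP.
have ses : @k_split_exact k gT P (coind P) (quotmod K) e (qproj K).
  split.
    split=> [x y xy|y|z]; first by rewrite -[x]e1 xy e1.
    - exact: (qproj_eq0 K y).
    - by have [y ->] := qproj_surj z; exists y.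
  (* The k-splitting picks in each class the unique representative vanishing at 1. *)
  pose s (z : quotmod K) : coind P := repr z - e (coev (repr z) 1%g).
  have sE y : s (qproj K y) = y - e (coev y 1%g).
    have [x xE] : K (repr (qproj K y) - y) by apply/qproj_eq; rewrite qproj_repr.
    rewrite /s -(subrK y (repr (qproj K y))) xE coevD e1 linearD opprD.
    by rewrite addrACA addrN add0r.
  have [|S SE] := @exists_linear k (underlying (quotmod K)) (underlying (coind P)) s.
    move=> c z z'; case: (qproj_surj z) (qproj_surj z') => y -> [y' ->].
    change (s (c%:C *: qproj K y + qproj K y') =
            c%:C *: s (qproj K y) + s (qproj K y')).
    rewrite -linearP !sE coev_klin linearP scalerBr opprD addrACA.
    by [].
  exists S => z; rewrite SE; have [y ->] := qproj_surj z.
  rewrite sE; apply/qproj_eq; rewrite addrAC addrN add0r.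
  by exists (- coev y 1%g); rewrite linearN.
have [_ _ /(_ idfun)[r rE]] := Pwi _ _ _ _ _ ses.
exists (fun x => r (codelta 1 x)).
  by move=> c x y; rewrite codelta_klinear linearP.
move=> x; rewrite -[RHS]/(idfun x) rE /= [e x]coind_sum linear_sum.
(* Translation by g^-1 moves the function supported at 1 to one supported at g, so the substitution
   of g^-1 for g matches the summands. *)
rewrite /trace (reindex_inj invg_inj); apply: eq_bigr => g _ /=.
by rewrite invgK -linearZ basis_codelta mul1g invgK coev_cofun.
Qed.

(** The splitting [s] yields a k-linear retraction [r] of [f], and [h \o r] extends [h] over [k].
    The trace of [t \o h \o r] is [kG]-linear and restricts along [f] to Tr(t) h = h. *)
Lemma higman_weakly_injective (P : lmodType kG) : higman P -> weakly_injective P.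
Proof.
move=> [t tk tP] A B C f g [[fI gf gS] [s sg]].
have sk : klinear (s : C -> B).
  by move=> c x y; apply: (linearP s c x y).
split=> [h h' hh' z|h|h]; first by have [y <-] := gS z; apply: hh'.
  split=> [hf|[h' hE] x]; last first.
    by rewrite hE /= (_ : g (f x) = 0) ?linear0 //; apply/gf; exists x.
  (* The difference of y and [s (g y)] lies in the image of [f], which [h] kills. This makes
     [h \o s] linear over [kG] although [s] is only k-linear. *)
  have hs y : h (s (g y)) = h y.
    have [x xE] : exists x, y - s (g y) = f x by apply/gf; rewrite linearB /= sg subrr.
    by rewrite -[in RHS](subrK (s (g y)) y) xE linearD hf add0r.
  have [|h' h'E] := @exists_linear kG C P (h \o s).
    move=> a x y; have [x' <-] := gS x; have [y' <-] := gS y.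
    by rewrite -linearP /= !hs linearP.
  by exists h' => y; rewrite /= h'E /= hs.
have rex y : exists x, f x = y - s (g y).
  have [x ->] : exists x, y - s (g y) = f x by apply/gf; rewrite linearB /= sg subrr.
  by exists x.
have [r rE] := choice rex.
have rk : klinear r.
  move=> c x y; apply: fI; rewrite linearP !rE linearP sk scalerBr.
  by rewrite opprD addrACA.
have rf x : r (f x) = x.
  have gf0 : g (f x) = 0 by apply/gf; exists x.
  by apply: fI; rewrite rE gf0 (klinear0 sk) subr0.
have hk : klinear (t \o (h \o r)).
  by do 2?apply: klinear_comp => //; apply: linear_klinear.
have [h' h'E] := exists_linear (trace_linear hk).
exists h' => x; rewrite /= h'E -[LHS]tP.
by apply: eq_bigr => y _; rewrite /= -[in RHS]linearZ rf linearZ.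
Qed.

Lemma weakly_injectiveE (P : lmodType kG) : weakly_injective P <-> higman P.
Proof. by split; [apply: weakly_injective_higman | apply: higman_weakly_injective]. Qed.

(** The conjugates of the projection onto the coordinate at 1 are the projections onto all
    coordinates, and these sum to the identity. *)
Lemma coind_higman (P : lmodType kG) : higman (coind P).
Proof.
exists (fun x => codelta 1 (coev x 1%g)).
  by move=> c x y; rewrite coev_klin codelta_klinear.
move=> x; rewrite [RHS]coind_sum (reindex_inj invg_inj); apply: eq_bigr => g _.
by rewrite coev_basis mul1g basis_codelta mul1g.
Qed.

Lemma higman_iso (P Q : lmodType kG) (f : {linear P -> Q}) (g : {linear Q -> P}) :
  cancel g f -> higman P -> higman Q.
Proof.
move=> gK [t tk tE]; exists (f \o (t \o g)).
  by do 2?apply: klinear_comp => //; apply: linear_klinear.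
by move=> x; rewrite trace_compl trace_compr tE gK.
Qed.

End Higman.

Lemma linear_inverse (R : pzRingType) (U V : lmodType R) (f : {linear U -> V}) :
  injective f -> (forall y, exists x, f x = y) ->
  exists g : {linear V -> U}, cancel f g /\ cancel g f.
Proof.
move=> fI /choice[g gK]; have [|h hE] := @exists_linear R V U g.
  by move=> a x y; apply: fI; rewrite linearP !gK.
by exists h; split=> [x|y]; rewrite hE ?gK //; apply: fI; rewrite gK.
Qed.

(** * Finite presentation *)

Section FinitePresentation.
Variables (k : comPzRingType) (gT : finGroupType).
Local Notation kG := (group_algebra k gT).
Local Notation "c %:C" := (gconst gT c) (at level 2, left associativity, format "c %:C").
Local Notation "''b_' g" := (gbasis k g) (at level 8, g at level 2, format "''b_' g").

Definition kcomb (F : lmodType kG) (I : finType) (x : I -> F) (c : I -> k) : F :=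
  \sum_i (c i)%:C *: x i.

Lemma kcombP (F : lmodType kG) (I : finType) (x : I -> F) a b c :
  kcomb x (fun i => a * b i + c i) = a%:C *: kcomb x b + kcomb x c.
Proof.
rewrite scaler_sumr -big_split; apply: eq_bigr => i _ /=.
by rewrite rmorphD rmorphM scalerDl scalerA.
Qed.

Lemma kcombB (F : lmodType kG) (I : finType) (x : I -> F) b c :
  kcomb x (fun i => b i - c i) = kcomb x b - kcomb x c.
Proof.
rewrite -sumrB; apply: eq_bigr => i _ /=.
by rewrite rmorphB scalerBl.
Qed.

Lemma eq_kcomb (F : lmodType kG) (I : finType) (x : I -> F) b c :
  b =1 c -> kcomb x b = kcomb x c.
Proof. by move=> bc; apply: eq_bigr => i _; rewrite bc. Qed.

Lemma kcomb_sum (F : lmodType kG) (I J : finType) (x : I -> F) (d : J -> k)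
    (r : J -> I -> k) :
  kcomb x (fun i => \sum_j d j * r j i) = \sum_j (d j)%:C *: kcomb x (r j).
Proof.
under [RHS]eq_bigr do rewrite scaler_sumr.
rewrite exchange_big; apply: eq_bigr => i _ /=.
rewrite rmorph_sum scaler_suml; apply: eq_bigr => j _.
by rewrite rmorphM scalerA.
Qed.

Lemma kcomb_scale (F : lmodType kG) (I : finType) (x : I -> F) a c :
  kcomb (fun i => a%:C *: x i) c = a%:C *: kcomb x c.
Proof.
rewrite scaler_sumr; apply: eq_bigr => i _.
by rewrite !scalerA -!(rmorphM (gconst gT)) mulrC.
Qed.

Lemma kcomb_delta (F : lmodType kG) (I : finType) (x : I -> F) i :
  kcomb x (fun j => (j == i)%:R) = x i.
Proof.
rewrite /kcomb (bigD1 i) //= big1 => [|j /negPf ->]; last by rewrite rmorph0 scale0r.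
by rewrite eqxx rmorph1 scale1r addr0.
Qed.

Lemma klinear_kcomb (F N : lmodType kG) (f : F -> N) (I : finType) (x : I -> F) c :
  klinear f -> f (kcomb x c) = kcomb (f \o x) c.
Proof.
move=> fk; rewrite /kcomb klinear_sum //; apply: eq_bigr => i _.
by rewrite klinearZ.
Qed.

Definition kspans (F : lmodType kG) (I : finType) (x : I -> F) : Prop :=
  forall y, exists c, y = kcomb x c.

Lemma kspans_ext (F N : lmodType kG) (I : finType) (x : I -> F) (f g : F -> N) :
  kspans x -> klinear f -> klinear g -> (forall i, f (x i) = g (x i)) -> f =1 g.
Proof.
move=> xs fk gk fg y; have [c ->] := xs y.
by rewrite !klinear_kcomb //; apply: eq_bigr => i _; rewrite /= fg.
Qed.

Definition kpresents (F : lmodType kG) (I J : finType) (x : I -> F)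
    (r : J -> I -> k) : Prop :=
  [/\ kspans x, forall j, kcomb x (r j) = 0
    & forall c, kcomb x c = 0 -> exists d, forall i, c i = \sum_j d j * r j i].

(* Since G is finite, this amounts to finite presentation over kG. *)
Definition fin_pres (F : lmodType kG) : Prop :=
  exists (I J : finType) (x : I -> F) (r : J -> I -> k), kpresents x r.

(** Two coefficient families of one element differ by a combination of relations, so chosen
    coefficients give a well-defined value. The presentation being over [k], the map is only
    k-linear; a [kG]-map is obtained from it by passing to a later stage of a colimit or by taking a
    trace. *)
Lemma kpresents_lift (F N : lmodType kG) (I J : finType) (x : I -> F)
    (r : J -> I -> k) (y : I -> N) :
  kpresents x r -> (forall j, kcomb y (r j) = 0) ->
  exists2 h : F -> N, klinear h & forall i, h (x i) = y i.
Proof.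
move=> [/choice[c cE] _ xr] yr.
have wd b b' : kcomb x b = kcomb x b' -> kcomb y b = kcomb y b'.
  move/eqP; rewrite -subr_eq0 -kcombB => /eqP/xr[d dE].
  apply/eqP; rewrite -subr_eq0 -kcombB (eq_kcomb _ dE) kcomb_sum.
  by rewrite big1 // => j _; rewrite yr scaler0.
exists (fun z => kcomb y (c z)) => [a z z'|i].
  by rewrite -kcombP; apply: wd; rewrite -cE kcombP -!cE.
by rewrite -[RHS]kcomb_delta; apply: wd; rewrite kcomb_delta -cE.
Qed.

Lemma fin_pres_iso (F F' : lmodType kG) (f : {linear F -> F'}) (g : {linear F' -> F}) :
  cancel f g -> cancel g f -> fin_pres F -> fin_pres F'.
Proof.
move=> fK gK [I [J [x [r [xs x0 xr]]]]]; exists I, J, (f \o x), r.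
have fc c : kcomb (f \o x) c = f (kcomb x c).
  by rewrite klinear_kcomb //; apply: linear_klinear.
split=> [y|j|c]; first by have [c cE] := xs (g y); exists c; rewrite fc -cE gK.
  by rewrite fc x0 linear0.
by rewrite fc => c0; apply: xr; rewrite -[LHS]fK c0 linear0.
Qed.

Lemma fin_pres_prod (F F' : lmodType kG) :
  fin_pres F -> fin_pres F' -> fin_pres (F * F')%type.
Proof.
move=> [I [J [x [r [xs x0 xr]]]]] [I' [J' [x' [r' [xs' x0' xr']]]]].
pose X (i : I + I') : F * F' := match i with inl i => (x i, 0) | inr i => (0, x' i) end.
pose S (j : J + J') (i : I + I') : k :=
  match j, i with inl j, inl i => r j i | inr j, inr i => r' j i | _, _ => 0 end.
exists (I + I')%type, (J + J')%type, X, S.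
have XE c : kcomb X c = (kcomb x (c \o inl), kcomb x' (c \o inr)).
  rewrite /kcomb big_sumType /=.
  have fk : klinear (fun y : F => (y, 0) : F * F').
    by move=> a y z; rewrite -[RHS]/(a%:C *: y + z, a%:C *: 0 + 0) scaler0 addr0.
  have gk : klinear (fun y : F' => (0, y) : F * F').
    by move=> a y z; rewrite -[RHS]/(a%:C *: 0 + 0, a%:C *: y + z) scaler0 addr0.
  rewrite -[LHS]/(kcomb ((fun y => (y, 0)) \o x) (c \o inl)
                  + kcomb ((fun y => (0, y)) \o x') (c \o inr)).
  by rewrite -!klinear_kcomb // -[LHS]/(_ + 0, 0 + _) addr0 add0r.
have kcomb0 (E : lmodType kG) (L : finType) (y : L -> E) : kcomb y (fun=> 0) = 0.
  by rewrite /kcomb big1 // => l _; rewrite rmorph0 scale0r.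
split=> [[y y']|j|c].
- have [[c cE] [c' cE']] := (xs y, xs' y').
  by exists (fun i => match i with inl i => c i | inr i => c' i end); rewrite XE cE cE'.
- rewrite XE; case: j => j /=.
    by rewrite -[X in _ = X]/(0, 0); congr pair; [exact: x0 | exact: kcomb0].
  by rewrite -[X in _ = X]/(0, 0); congr pair; [exact: kcomb0 | exact: x0'].
rewrite XE => -[/xr[d dE] /xr'[d' dE']].
exists (fun j => match j with inl j => d j | inr j => d' j end).
case=> i; rewrite big_sumType /=.
  by rewrite [X in _ + X]big1 ?addr0 => [|j _]; [apply: dE | rewrite mulr0].
by rewrite [X in X + _]big1 ?add0r => [|j _]; [apply: dE' | rewrite mulr0].
Qed.

(** Over [k] this is a finite power of [F], so generators and relations are repeated once per group
    element. *)
Lemma fin_pres_coind (F : lmodType kG) : fin_pres F -> fin_pres (coind F).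
Proof.
move=> [I [J [x [r [xs x0 xr]]]]].
pose X (i : gT * I) : coind F := codelta i.1 (x i.2).
pose S (j : gT * J) (i : gT * I) : k := if i.1 == j.1 then r j.2 i.2 else 0.
exists (gT * I)%type, (gT * J)%type, X, S.
have XE c g : coev (kcomb X c) g = kcomb x (fun i => c (g, i)).
  have -> : kcomb X c = \sum_h \sum_i (c (h, i))%:C *: codelta h (x i).
    by rewrite pair_bigA; apply: eq_bigr => -[].
  rewrite coev_sum (bigD1 g) //= coev_sum [X in _ + X]big1 ?addr0 => [|h hg].
    by apply: eq_bigr => i _; rewrite coev_const coev_cofun eqxx.
  rewrite coev_sum big1 // => i _.
  by rewrite coev_const coev_cofun eq_sym (negPf hg) scaler0.
split=> [y|[h j]|c c0].
- have /choice[c cE] := fun g => xs (coev y g).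
  by exists (fun i => c i.1 i.2); apply: coev_inj => g; rewrite XE.
- apply: coev_inj => g; rewrite XE /S /= /coev ffunE; case: eqP => _ //.
  by rewrite /kcomb big1 // => i _; rewrite rmorph0 scale0r.
have /choice[d dE] g : exists d, forall i, c (g, i) = \sum_j d j * r j i.
  by apply: xr; rewrite -XE c0 /coev ffunE.
exists (fun j => d j.1 j.2) => -[g i].
transitivity (\sum_h \sum_j d h j * S (h, j) (g, i)); last first.
  by rewrite pair_bigA; apply: eq_bigr => -[].
rewrite (bigD1 g) //=.
rewrite [X in _ + X]big1 ?addr0 => [|h hg]; rewrite /S /=.
  by rewrite eqxx; apply: dE.
by rewrite eq_sym (negPf hg) big1 // => j _; rewrite mulr0.
Qed.

(** Each [z l], expanded in the generators of [F], contributes one further relation. *)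
Lemma fin_pres_quot (F : lmodType kG) (K : submodule F) (L : finType) (z : L -> F) :
  fin_pres F -> (forall y, K y <-> exists d, y = kcomb z d) -> fin_pres (quotmod K).
Proof.
move=> [I [J [x [r [xs x0 xr]]]]] KE.
have /choice[a aE] := fun l => xs (z l).
exists I, (J + L)%type, (qproj K \o x),
  (fun j => match j with inl j => r j | inr l => a l end).
have qc c : kcomb (qproj K \o x) c = qproj K (kcomb x c).
  by rewrite [RHS]klinear_kcomb //; apply: linear_klinear.
split=> [y|[j|l]|c].
- by have [w ->] := qproj_surj y; have [c ->] := xs w; exists c; rewrite qc.
- by rewrite qc x0 linear0.
- rewrite qc -aE; apply/qproj_eq0/KE; exists (fun j => (j == l)%:R).
  by rewrite kcomb_delta.
rewrite qc => /qproj_eq0/KE[d dE].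
have [|b bE] := xr (fun i => c i - \sum_l d l * a l i).
  rewrite kcombB dE kcomb_sum; apply/eqP; rewrite subr_eq0; apply/eqP.
  by apply: eq_bigr => l _; rewrite aE.
exists (fun j => match j with inl j => b j | inr l => d l end) => i.
by rewrite big_sumType /= -bE subrK.
Qed.

Lemma fin_pres_regular : fin_pres (kG^o : lmodType kG).
Proof.
exists gT, void, (fun g => 'b_g : kG^o), (fun=> fun=> 0).
split=> [y|[]|c c0]; first by exists (coef y); rewrite [LHS]group_algebra_sum.
exists (fun=> 0) => g; rewrite big_pred0; last by case.
have -> : c g = coef (kcomb (fun g => 'b_g : kG^o) c) g.
  rewrite coef_sum (bigD1 g) //= big1 ?addr0 => [|h hg].
    rewrite /GRing.scale /= coefM (bigD1 1%g) //= big1 => [|y y1].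
      by rewrite addr0 coef_gconst coef_gbasis invg1 mul1g !eqxx mulr1.
    by rewrite coef_gconst (negPf y1) mul0r.
  rewrite /GRing.scale /= coefM big1 // => y _; rewrite coef_gconst coef_gbasis.
  have [->|_] := eqVneq y 1%g; last by rewrite mul0r.
  by rewrite invg1 mul1g eq_sym (negPf hg) mulr0.
by rewrite c0 /coef ffunE.
Qed.

(** Supplies the models stored in [fp_over]: generators over [k] also generate over [kG], and the
    kernel of the map from the free module on them is [K]. *)
Lemma fin_pres_small (F : lmodType kG) : fin_pres F ->
  exists n (K : submodule 'rV[kG]_n) (f : {linear quotmod K -> F})
    (g : {linear F -> quotmod K}), cancel f g /\ cancel g f.
Proof.
move=> [I [_ [x [_ [xs _ _]]]]].
pose e (v : 'rV[kG]_#|I|) : F := \sum_i v 0 i *: x (enum_val i).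
have [|E EE] := @exists_linear kG 'rV[kG]_#|I| F e.
  move=> a v w; rewrite /e scaler_sumr -big_split; apply: eq_bigr => i _.
  by rewrite !mxE scalerDl scalerA.
have KP a v w : E v = 0 -> E w = 0 -> E (a *: v + w) = 0.
  by move=> v0 w0; rewrite linearP v0 w0 scaler0 addr0.
pose K := Submodule (linear0 E) KP.
have [f fE] := @quot_lift kG _ K F E (fun v Ev => Ev).
exists #|I|, K, f; apply: linear_inverse => [a b|y].
  have [v ->] := qproj_surj a; have [w ->] := qproj_surj b; rewrite !fE => vw.
  by apply/qproj_eq; rewrite /= linearB vw subrr.
have [c ->] := xs y; exists (qproj K (\row_i (c (enum_val i))%:C)).
rewrite fE EE /e /kcomb [RHS](reindex _ (onW_bij _ (@enum_val_bij I))) /=.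
by apply: eq_bigr => i _; rewrite mxE.
Qed.

End FinitePresentation.

(** * Traceable modules as filtered colimits *)

Section Assembly.
Variables (k : comPzRingType) (gT : finGroupType).
Local Notation kG := (group_algebra k gT).
Local Notation "c %:C" := (gconst gT c) (at level 2, left associativity, format "c %:C").
Local Notation "''b_' g" := (gbasis k g) (at level 8, g at level 2, format "''b_' g").

Definition traceable (M : lmodType kG) : Prop :=
  forall F : lmodType kG, fin_pres F -> forall f : {linear F -> M},
    exists2 t : F -> M, klinear t & trace t =1 f.

Variable M : lmodType kG.
Hypothesis Mt : traceable M.

(* The object is stored as a quotient of a free module of finite rank, so that
   the index category lives in the same universe as the modules. *)
Record fp_over := FpOver {
  rk : nat;
  rel : submodule 'rV[kG]_rk;
  fp_map : {linear quotmod rel -> M};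
  fp_overP : fin_pres (quotmod rel) /\ weakly_injective (quotmod rel)
}.

(** With [f] the trace of [t], the map from [coind Q] to [M] is the trace of [t] after evaluation at
    1; precomposed with the unit, it gives back [f]. Since [coind Q] is finitely presented and
    weakly injective, it is an object over [M] up to isomorphism. *)
Lemma fp_over_cofinal (Q : lmodType kG) (f : {linear Q -> M}) : fin_pres Q ->
  exists (i : fp_over) (u : {linear Q -> quotmod (rel i)}),
    forall x, fp_map i (u x) = f x.
Proof.
move=> Qfp; have [t tk tE] := Mt Qfp f.
have ek : klinear (fun y : coind Q => coev y 1%g) by move=> c x y; rewrite coev_klin.
have [h hE] := exists_linear (trace_linear (klinear_comp tk ek)).
have Wfp := fin_pres_coind Qfp.
have [n [K [a [b [aK bK]]]]] := fin_pres_small Wfp.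
have KP : fin_pres (quotmod K) /\ weakly_injective (quotmod K).
  split; first exact: fin_pres_iso bK aK Wfp.
  by apply/weakly_injectiveE; apply: higman_iso aK _; apply: coind_higman.
exists (@FpOver n K (h \o a) KP), (b \o @coind_unit k gT Q) => x /=.
rewrite bK hE -trace_compr -tE; apply: eq_bigr => g _ /=.
by rewrite coev_cofun gbasis1 scale1r.
Qed.

(** Plain functions with proofs attached, so that morphisms are equal as soon as the functions are;
    [fp_dmap] recovers a bundled linear map. *)
Definition fp_hom (i j : fp_over) : Type :=
  {u : quotmod (rel i) -> quotmod (rel j) |
    linear u /\ forall x, fp_map j (u x) = fp_map i x}.

Definition fp_id i : fp_hom i i.
Proof. by exists id. Defined.

Definition fp_comp i j l (v : fp_hom j l) (u : fp_hom i j) : fp_hom i l.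
Proof.
exists (sval v \o sval u); case: u v => u [ul uE] [v [vl vE]].
by split=> [a x y|x] /=; rewrite ?ul ?vl // vE uE.
Defined.

Lemma fp_hom_eq i j (u v : fp_hom i j) : sval u = sval v -> u = v.
Proof. by case: u v => u up [v vp] /= uv; apply: eq_exist. Qed.

Definition fp_category : category.
Proof.
by apply: (@Category fp_over fp_hom fp_id fp_comp) => *; apply: fp_hom_eq.
Defined.

Definition fp_dmap i j (u : fp_hom i j) := sval (cid (exists_linear (svalP u).1)).

Lemma fp_dmapE i j (u : fp_hom i j) : fp_dmap u =1 sval u.
Proof. by rewrite /fp_dmap; case: (cid _). Qed.

Definition fp_diagram : diagram fp_category kG.
Proof.
apply: (@Diagram fp_category kG (fun i : fp_over => quotmod (rel i)) fp_dmap).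
  by move=> i x; rewrite fp_dmapE.
by move=> i j l v u x; rewrite /= !fp_dmapE.
Defined.

Lemma fp_hom_exists (i j : fp_over) (u : {linear quotmod (rel i) -> quotmod (rel j)}) :
  (forall x, fp_map j (u x) = fp_map i x) ->
  exists v : fp_hom i j, fp_dmap v =1 u.
Proof.
move=> uE; pose v : fp_hom i j := exist _ (u : _ -> _) (conj (fun a => linearP u a) uE).
by exists v => x; rewrite fp_dmapE.
Qed.

(** The structure map factors through the quotient by [K], still finitely presented because [K] is
    finitely generated over [k]; cofinality then maps this quotient to an object over [M]. *)
Lemma fp_over_kill (i : fp_over) (K : submodule (quotmod (rel i))) (L : finType)
    (z : L -> quotmod (rel i)) :
  (forall y, K y <-> exists d, y = kcomb z d) ->
  (forall y, K y -> fp_map i y = 0) ->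
  exists j (u : fp_hom i j),
    forall y, K y -> fp_dmap u y = 0.
Proof.
move=> KE K0; have [f fE] := quot_lift K0.
have [j [u uE]] := fp_over_cofinal f (fin_pres_quot (fp_overP i).1 KE).
have [|v vE] := @fp_hom_exists i j (u \o qproj K) _; first by move=> x /=; rewrite uE fE.
by exists j, v => y Ky; rewrite vE /= (qproj_eq0 K y).2 // linear0.
Qed.

Lemma fp_category_filtered : filtered fp_category.
Proof.
split.
- by have [i _] := fp_over_cofinal \0%R (fin_pres_regular k gT); constructor.
(* The direct sum over [M] receives both objects, and cofinality sends it to a weakly injective
   one. *)
- move=> i j; pose f := fun x : quotmod (rel i) * quotmod (rel j) => fp_map i x.1 + fp_map j x.2.
  have [|F FE] := @exists_linear kG (quotmod (rel i) * quotmod (rel j))%type M f.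
    by move=> a x y; rewrite /f /= !linearP /= scalerDr addrACA.
  have [l [u uE]] := fp_over_cofinal F (fin_pres_prod (fp_overP i).1 (fp_overP j).1).
  exists l; split.
    have [|s sE] := @exists_linear kG _ _ (fun x : quotmod (rel i) => u (x, 0)).
      by move=> a x y; rewrite -linearP; congr (u _); congr pair; rewrite /= scaler0 addr0.
    have [|v _] := @fp_hom_exists i l s; last by constructor.
    by move=> x; rewrite sE uE FE /f linear0 addr0.
  have [|s sE] := @exists_linear kG _ _ (fun x : quotmod (rel j) => u (0, x)).
    by move=> a x y; rewrite -linearP; congr (u _); congr pair; rewrite /= scaler0 addr0.
  have [|v _] := @fp_hom_exists j l s; last by constructor.
  by move=> x; rewrite sE uE FE /f linear0 add0r.
(* To equalise [u] and [v], kill the image of their difference: it is spanned by the images of the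
   generators of the source, and it vanishes in [M] because both maps lie over [M]. *)
- move=> i j u v; have [[I [_ [x [_ [xs _ _]]]]] _] := fp_overP i.
  pose d y := fp_dmap u y - fp_dmap v y.
  have dl a y z : d (a *: y + z) = a *: d y + d z.
    by rewrite /d !linearP addrACA -scalerDr.
  have [D DE] := @exists_linear kG (quotmod (rel i)) (quotmod (rel j)) d dl.
  have K0 : exists y, 0 = D y by exists 0; rewrite linear0.
  have KP a y z : (exists w, y = D w) -> (exists w, z = D w) ->
      exists w, a *: y + z = D w.
    by move=> [w ->] [w' ->]; exists (a *: w + w'); rewrite linearP.
  pose K := Submodule K0 KP.
  have [y||l [w wE]] := @fp_over_kill j K I (D \o x).
  - split=> [[w ->]|[c ->]].
      have [c ->] := xs w; exists c; rewrite klinear_kcomb //; exact: linear_klinear.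
    by exists (kcomb x c); rewrite klinear_kcomb //; apply: linear_klinear.
  - move=> _ [y ->]; rewrite DE /d linearB /= !fp_dmapE.
    by rewrite (svalP u).2 (svalP v).2 subrr.
  exists l, w; apply: fp_hom_eq; apply/funext => y /=.
  rewrite -!fp_dmapE; apply/eqP; rewrite -subr_eq0 -linearB; apply/eqP.
  by apply: wE; exists y; rewrite DE.
Qed.

Lemma traceable_cw_injective : cw_injective M.
Proof.
exists fp_category, fp_diagram, M, (fun i : fp_over => fp_map i).
split; first exact: fp_category_filtered.
- by move=> i; exact: (fp_overP i).2.
- apply: (is_colimit_filtered fp_category_filtered).
  + by move=> i j u x /=; rewrite fp_dmapE (svalP u).2.
  (* An element m is the image of 1 under a map from the regular module, which is finitely
     presented. *)
  + move=> m; have [|f fE] := @exists_linear kG kG^o M (fun a => a *: m).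
      by move=> a b c; rewrite scalerDl scalerA.
    have [i [u uE]] := fp_over_cofinal f (fin_pres_regular k gT).
    by exists i, (u 1); rewrite uE fE scale1r.
  (* The submodule generated by x is spanned over [k] by the finitely many translates of x, so
     [fp_over_kill] applies. *)
  move=> i x x0; have K0 : exists a : kG, 0 = a *: x by exists 0; rewrite scale0r.
  have KP a y z : (exists b : kG, y = b *: x) -> (exists b : kG, z = b *: x) ->
      exists b : kG, a *: y + z = b *: x.
    by move=> [b ->] [c ->]; exists (a * b + c); rewrite scalerDl scalerA.
  have [y||j [u uE]] := @fp_over_kill i (Submodule K0 KP) gT (fun g => 'b_g *: x).
  - split=> [[a ->]|[d ->]].
      exists (coef a); rewrite [in LHS](group_algebra_sum a) scaler_suml.
      by apply: eq_bigr => g _; rewrite scalerA.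
    exists (\sum_g (d g)%:C * 'b_g); rewrite scaler_suml.
    by apply: eq_bigr => g _; rewrite scalerA.
  - by move=> _ [a ->]; rewrite linearZ /= x0 scaler0.
  by exists j, u; apply: uE; exists 1; rewrite scale1r.
- by exists idfun; exists id.
Qed.

End Assembly.

(** * Traceability of filtered colimits of weakly injective modules *)

Section FilteredTraceable.
Variables (k : comPzRingType) (gT : finGroupType).
Local Notation kG := (group_algebra k gT).
Local Notation "c %:C" := (gconst gT c) (at level 2, left associativity, format "c %:C").
Local Notation "''b_' g" := (gbasis k g) (at level 8, g at level 2, format "''b_' g").

Lemma traceable_iso (M N : lmodType kG) (f : {linear M -> N}) (g : {linear N -> M}) :
  cancel g f -> traceable M -> traceable N.
Proof.
move=> gK Mt F Ffp h; have [t tk tE] := Mt F Ffp (g \o h).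
exists (f \o t); first by apply: klinear_comp => //; apply: linear_klinear.
by move=> x; rewrite trace_compl tE /= gK.
Qed.

(** A map from a finitely presented module factors through one stage, because being such a
    factorisation is a finite list of equations. At that stage the identity is a trace, hence so is
    the composite. *)
Lemma filtered_traceable (I : category) (D : diagram I kG) (L : lmodType kG)
    (c : forall i, {linear D i -> L}) :
  filtered I -> is_cocone c -> jointly_surjective c -> kernels_die c ->
  (forall i, higman (D i)) -> traceable L.
Proof.
move=> If cc cs ck Dh F [S [J [x [r xr]]]] f; have [xs x0 _] := xr.
have fk := linear_klinear f; have ckl i := linear_klinear (c i).
have [|a|i /choice[y yE]] :=
    @filtered_bound _ If S (fun a i => exists y : D i, f (x a) = c i y).
- by move=> a i j u [y ->]; exists (dmap D u y); rewrite -(cc _ _ u).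
- by have [i [y yE]] := cs (f (x a)); exists i, y.
(* The lifted generators satisfy the relations in [L], hence at a later stage, which gives a
   k-linear lift [h] of [f]. *)
have [||j [u uE]] := @filtered_refine _ If J i
    (fun b j u => dmap D u (kcomb y (r b)) = 0).
- by move=> b j l u v uy; rewrite dmap_comp /= uy linear0.
- move=> b; apply: ck; rewrite klinear_kcomb //.
  transitivity (f (kcomb x (r b))); last by rewrite x0 linear0.
  by rewrite klinear_kcomb //; apply: eq_bigr => a _; rewrite /= yE.
have [b|h hk hE] := @kpresents_lift _ _ F (D j) S J x r (dmap D u \o y) xr.
  by rewrite -klinear_kcomb ?uE //; apply: linear_klinear.
have ch : c j \o h =1 f.
  apply: (kspans_ext xs) => //; first exact: klinear_comp.
  by move=> a; rewrite /= hE /= yE; apply: cc.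
(* Equivariance of [h] holds after [c j]. On generators it amounts to finitely many equations, so it
   is attained at a later stage. *)
have [||l [v vE]] := @filtered_refine _ If (gT * S)%type j
    (fun ga l v => dmap D v (h ('b_ga.1 *: x ga.2) - 'b_ga.1 *: h (x ga.2)) = 0).
- by move=> ga l m v w vE; rewrite dmap_comp /= vE linear0.
- move=> [g a]; apply: ck; rewrite linearB linearZ /=.
  by rewrite !(ch _ : c j (h _) = f _) linearZ subrr.
have [t tk tE] := Dh l; pose H := dmap D v \o h.
have Hk : klinear H by apply: klinear_comp => //; apply: linear_klinear.
have bk (A : lmodType kG) (g : gT) : klinear (fun z : A => 'b_g *: z).
  by move=> d z w; rewrite scalerDr !scalerA gconst_basisC.
have HG g z : H ('b_g *: z) = 'b_g *: H z.
  apply: (kspans_ext xs (f := H \o (fun z => 'b_g *: z))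
                         (g := (fun z => 'b_g *: z) \o H)) z.
  - exact: (klinear_comp Hk (bk F g)).
  - exact: (klinear_comp (bk _ g) Hk).
  move=> a; apply/eqP; rewrite -subr_eq0 /= -[X in _ - X]linearZ -linearB.
  by apply/eqP; apply: (vE (g, a)).
have [H' H'E] := exists_linear (klinear_equivariant Hk HG).
exists (c l \o (t \o H')); first by do 2?apply: klinear_comp => //; apply: linear_klinear.
move=> z; rewrite trace_compl trace_compr tE -ch /= H'E; exact: cc.
Qed.

End FilteredTraceable.

(** * Base change *)

Section BaseChange.
Variables (k k' : comPzRingType) (gT : finGroupType) (phi : {rmorphism k -> k'}).
Local Notation kG := (group_algebra k gT).
Local Notation kG' := (group_algebra k' gT).

Definition base_change (a : kG) : kG' := [ffun g => phi (coef a g)].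

Lemma coef_base_change a g : coef (base_change a) g = phi (coef a g).
Proof. by rewrite /coef ffunE. Qed.

Fact base_change_is_zmod_morphism : zmod_morphism base_change.
Proof.
by move=> a b; apply/ffunP => g; rewrite !ffunE -rmorphB /coef !ffunE.
Qed.

Lemma base_change_basis g : base_change (gbasis k g) = gbasis k' g.
Proof. by apply: coef_inj => h; rewrite coef_base_change !coef_gbasis rmorph_nat. Qed.

Lemma base_change_const c : base_change (gconst gT c) = gconst gT (phi c).
Proof. by apply: coef_inj => h; rewrite coef_base_change !coef_gconst rmorphMn. Qed.

Fact base_change_is_monoid_morphism : monoid_morphism base_change.
Proof.
split=> [|a b]; first exact: base_change_basis.
apply: coef_inj => g; rewrite coef_base_change !coefM rmorph_sum.
by apply: eq_bigr => h _; rewrite rmorphM !coef_base_change.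
Qed.

HB.instance Definition _ := GRing.isZmodMorphism.Build kG kG' base_change
  base_change_is_zmod_morphism.
HB.instance Definition _ := GRing.isMonoidMorphism.Build kG kG' base_change
  base_change_is_monoid_morphism.

Local Notation res := (restrict base_change).

Lemma restrict_linear_subproof (V W : lmodType kG') (f : {linear V -> W}) :
  linear (f : res V -> res W).
Proof. by move=> a x y; apply: linearP. Qed.

Definition restrict_linear (V W : lmodType kG') (f : {linear V -> W}) :=
  sval (cid (exists_linear (restrict_linear_subproof f))).

Lemma restrict_linearE (V W : lmodType kG') (f : {linear V -> W}) :
  restrict_linear f =1 f.
Proof. by rewrite /restrict_linear; case: cid. Qed.

Definition restrict_diagram (I : category) (D : diagram I kG') : diagram I kG.
Proof.
apply: (@Diagram I kG (fun i => res (D i)) (fun i j u => restrict_linear (dmap D u))).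
  by move=> i x; rewrite restrict_linearE dmap_id.
by move=> i j l v u x; rewrite /= !restrict_linearE dmap_comp.
Defined.

(** The same [t] works, since base change carries group elements to group elements and the trace
    involves no other scalars. *)
Lemma higman_restrict (P : lmodType kG') : higman P -> higman (res P).
Proof.
move=> [t tk tE]; exists t.
  move=> c x y.
  change (t (base_change (gconst gT c) *: (x : P) + (y : P))
          = base_change (gconst gT c) *: t x + t y).
  by rewrite base_change_const; apply: tk.
move=> x; rewrite -[RHS]tE; apply: eq_bigr => g _.
change (base_change (gbasis k g) *: t (base_change (gbasis k g^-1) *: (x : P))
        = gbasis k' g *: t (gbasis k' g^-1 *: (x : P))).
by rewrite !base_change_basis.
Qed.

(** Restriction leaves the elements and the maps unchanged, so the elementwise description of the
    colimit and the Higman maps carry over to [kG]. Finitely presented [kG]-modules can then be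
    mapped into [N] without being base changed. *)
Lemma cw_injective_restrict_traceable (N : lmodType kG') :
  cw_injective N -> traceable (res N).
Proof.
move=> [I [D [L [c [If Dwi cL [f [g fK gK]]]]]]].
have [g' [_ gK']] : exists g' : {linear L -> N}, cancel f g' /\ cancel g' f.
  by apply: linear_inverse => [|y]; [apply: can_inj fK | exists (g y)].
have fK' : cancel f g'.
  by move=> x; apply: (can_inj fK); rewrite gK'.
apply: (@traceable_iso _ _ (res L) (res N) (restrict_linear g') (restrict_linear f)).
  by move=> x; rewrite !restrict_linearE.
apply: (@filtered_traceable _ _ I (restrict_diagram D) (res L)
         (fun i => restrict_linear (c i))) => //.
- by move=> i j u x; rewrite /= !restrict_linearE; apply: cL.1.
- move=> y; have [i [x yE]] := colimit_jointly_surjective If cL y.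
  by exists i, x; rewrite restrict_linearE.
- move=> i x; rewrite restrict_linearE => /(colimit_kernels_die If cL)[j [u ux]].
  by exists j, u; rewrite /= restrict_linearE.
- by move=> i; apply/higman_restrict/weakly_injectiveE.
Qed.

End BaseChange.

(** * Maximal ideals containing a proper ideal *)

Section MaximalIdeals.
Variable k : comPzRingType.
Local Open Scope classical_set_scope.

Lemma ideal_sub_max (J : set k) : is_ideal J -> ~ J 1 ->
  exists p : max_ideal k, J `<=` p.
Proof.
move=> [J0 JD JM] J1.
(* Adjoining [J] inside the property makes the empty set qualify, so the union of the empty chain
   causes no exception in Zorn's lemma. *)
pose P (X : set k) := is_ideal (J `|` X) /\ ~ (J `|` X) 1.
have [|A [[AI A1] Amax]] := @Zorn_bigcup k P.
  move=> F FP Ftot; split; last first.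
    by case=> // -[X FX X1]; have [_] := FP X FX; apply; right.
  split; first by left.
    have cas x y : (J `|` \bigcup_(X in F) X) x -> (J `|` \bigcup_(X in F) X) y ->
        (J x /\ J y) \/ exists X, [/\ F X, (J `|` X) x & (J `|` X) y].
      case=> [Jx|[X FX Xx]] [Jy|[Y FY Yy]]; first by left.
      - by right; exists Y; split=> //; [left | right].
      - by right; exists X; split=> //; [right | left].
      - have [XY|YX] := Ftot X Y FX FY; right.
          by exists Y; split=> //; right => //; apply: XY.
        by exists X; split=> //; right => //; apply: YX.
    move=> x y Jx Jy; have [[{}Jx {}Jy]|[X [FX Xx Xy]]] := cas _ _ Jx Jy.
      by left; apply: JD.
    have [[_ XD _] _] := FP X FX.
    by case: (XD _ _ Xx Xy) => ?; [left | right; exists X].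
  move=> a x [Jx|[X FX Xx]]; first by left; apply: JM.
  have [[_ _ XM] _] := FP X FX.
  by case: (XM a x (or_intror Xx)) => ?; [left | right; exists X].
have pmax : is_max_ideal (J `|` A).
  split=> //; first by move=> AT; apply: A1; rewrite AT.
  move=> K KI AK; have [K1|K1] := pselect (K 1).
    right; apply/seteqP; split=> // x _; rewrite -[x]mulr1.
    by case: KI => _ _; apply.
  left; apply/seteqP; split=> //; apply: contrapT => KA.
  have JK : J `|` K = K by apply/setUidPr => x Jx; apply: AK; left.
  apply: (Amax K); last by rewrite /P JK.
  split; first by move=> x Ax; apply: AK; right.
  by move=> KsubA; apply: KA => x /KsubA; right.
by exists (MaxIdeal pmax) => x Jx; left.
Qed.

End MaximalIdeals.

(** * Localized modules *)

Section Localized.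
Variables (k : comPzRingType) (gT : finGroupType) (p : max_ideal k).
Local Notation kp := (localization p).
Local Notation kG := (group_algebra k gT).
Local Notation kpG := (group_algebra kp gT).
Local Notation U := (restrict (@to_loc k p) kp^o).
Local Notation "c %:C" := (gconst gT c) (at level 2, left associativity, format "c %:C").
Local Notation "''b_' g" := (gbasis k g) (at level 8, g at level 2, format "''b_' g").

(** Induction as in [filtered_bound], with products of denominators in place of cospans. *)
Lemma common_denom (T : finType) (P : T -> denom p -> Prop) :
  (forall a s t, P a s -> P a (mul_denom t s)) ->
  (forall a, exists s, P a s) -> exists s, forall a, P a s.
Proof.
move=> Pup Pex; suff [s sP] : exists s, forall a, a \in enum T -> P a s.
  by exists s => a; apply: sP; rewrite mem_enum.
elim: (enum T) => [|a r [s sP]]; first by exists (one_denom p).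
have [t tP] := Pex a; exists (mul_denom s t) => b; rewrite inE.
case/predU1P=> [->|/sP]; first exact: Pup.
have -> : mul_denom s t = mul_denom t s by apply: val_inj; rewrite /= mulrC.
exact: Pup.
Qed.

(** * Elements of the localised module *)

Section OneModule.
Variable M : lmodType kG.

Definition lpure (x : kp) (m : M) : localized_module p M :=
  pure (x : U) (m : underlying M).

Lemma lpureDl x y m : lpure (x + y) m = lpure x m + lpure y m.
Proof. by have := (pure_bilinear U (underlying M)).1 m 1 x y; rewrite !scale1r. Qed.

Lemma lpureDr x m n : lpure x (m + n) = lpure x m + lpure x n.
Proof. by have := (pure_bilinear U (underlying M)).2 x 1 m n; rewrite !scale1r. Qed.

Lemma lpure0r x : lpure x 0 = 0.
Proof. by apply: (addrI (lpure x 0)); rewrite -lpureDr !addr0. Qed.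

Lemma lpure0l m : lpure 0 m = 0.
Proof. by apply: (addrI (lpure 0 m)); rewrite -lpureDl !addr0. Qed.

Lemma lpure_sum (J : Type) (r : seq J) (F : J -> M) x :
  lpure x (\sum_(j <- r) F j) = \sum_(j <- r) lpure x (F j).
Proof. by elim/big_rec2: _ => [|j y z _ <-]; rewrite ?lpure0r ?lpureDr. Qed.

Lemma lpure_move c x m : lpure (to_loc p c * x) m = lpure x (c%:C *: m).
Proof.
have [l r] := pure_bilinear U (underlying M).
have := l m c x 0; have := r x c m 0; rewrite !addr0.
rewrite -!/(lpure _ _) => rE lE.
transitivity (c *: (pure (x : U) (m : underlying M))).
  by rewrite -[RHS]addr0 -[X in _ + X](lpure0l m).
by rewrite -[LHS]addr0 -[X in _ + X](lpure0r x).
Qed.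

Lemma scale_lpure_const c x m : gconst gT c *: lpure x m = lpure (c * x) m.
Proof.
have := scale_localized_pure c 1%g x m.
by rewrite !gbasis1 mulr1 scale1r.
Qed.

Lemma scale_lpure_basis g x m : gbasis kp g *: lpure x m = lpure x ('b_g *: m).
Proof.
have := scale_localized_pure 1 g x m.
by rewrite rmorph1 !mul1r.
Qed.

(** Numerators move across the tensor sign, and terms with denominators s and s' add over s s'. *)
Lemma lpure_surj t : exists (s : denom p) m, t = lpure (frac 1 s) m.
Proof.
rewrite [t]tensor_sum_pure; elim/big_ind: _ => [|u v|[x m] _].
- by exists (one_denom p), 0; rewrite lpure0r.
- move=> [s [m ->]] [s' [m' ->]]; exists (mul_denom s s').
  exists ((dval s')%:C *: m + (dval s)%:C *: m').
  rewrite lpureDr -!lpure_move /to_loc !fracM.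
  by congr (lpure _ _ + lpure _ _); apply: frac_eq1; rewrite !dvalM dval1; ring.
have [y [s /= ->]] := fracP x; exists s, (y%:C *: m).
rewrite -lpure_move /to_loc fracM -/(lpure _ _); congr lpure.
by apply: frac_eq1; rewrite !dvalM dval1; ring.
Qed.

(* S^-1 M as the filtered colimit of copies of M indexed by S, with transition
   map u : M_s -> M_t for each u with t = u s. *)
Definition denom_hom (s t : denom p) : Type := {u : k | dval t = u * dval s}.

Lemma denom_hom_eq s t (u v : denom_hom s t) : sval u = sval v -> u = v.
Proof. by case: u v => u up [v vp] /= uv; apply: eq_exist. Qed.

Definition denom_id s : denom_hom s s.
Proof. by exists 1; rewrite mul1r. Defined.

Definition denom_comp r s t (v : denom_hom s t) (u : denom_hom r s) : denom_hom r t.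
Proof. by exists (sval v * sval u); rewrite -mulrA -(svalP u) -(svalP v). Defined.

Definition denom_category : category.
Proof.
apply: (@Category (denom p) denom_hom denom_id denom_comp) => *;
  apply: denom_hom_eq => /=.
- by rewrite mul1r.
- by rewrite mulr1.
- by rewrite mulrA.
Defined.

Lemma denom_filtered : filtered denom_category.
Proof.
split; first exact: (inhabits (one_denom p)).
  move=> s t; exists (mul_denom s t); split; constructor.
    by exists (dval t); rewrite dvalM mulrC.
  by exists (dval s); rewrite dvalM.
(* Both u s and v s equal t, so multiplication by s, an arrow from t to s t, equalises [u] and
   [v]. *)
move=> s t u v; exists (mul_denom s t).
have w : denom_hom t (mul_denom s t) by exists (dval s); rewrite dvalM.
have wE : dval s * dval t = sval w * dval t by rewrite -dvalM; apply: (svalP w).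
unshelve eexists; first by exists (dval s); rewrite dvalM.
apply: denom_hom_eq; rewrite /= [LHS]mulrC [RHS]mulrC.
by rewrite -(svalP u) -(svalP v).
Qed.

Lemma denom_scale_subproof c : linear (fun m : underlying M => c *: m).
Proof. by move=> a x y; rewrite scalerDr !scalerA mulrC. Qed.

Definition denom_dmap s t (u : denom_hom s t) :=
  sval (cid (exists_linear (denom_scale_subproof (sval u)))).

Lemma denom_dmapE s t (u : denom_hom s t) m : denom_dmap u m = sval u *: m.
Proof. by rewrite /denom_dmap; case: cid. Qed.

Definition denom_diagram : diagram denom_category k.
Proof.
apply: (@Diagram denom_category k (fun=> underlying M) denom_dmap).
  by move=> s m; rewrite denom_dmapE scale1r.
by move=> r s t v u m; rewrite /= !denom_dmapE scalerA.
Defined.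

(** Vanishing in the tensor product is tested on one bilinear map, sending x/s and n to the class of
    x n at stage s of the colimit. A zero class at stage 1 means that a transition map,
    multiplication by a denominator, kills m. *)
Lemma lpure_eq0 m : lpure 1 m = 0 -> exists s : denom p, (dval s)%:C *: m = 0.
Proof.
pose L : lmodType k := fcolim denom_diagram denom_filtered.
pose inj (s : denom p) (n : underlying M) : L :=
  @ginj _ _ denom_diagram denom_filtered s n.
have injP s a n n' : inj s (a *: n + n') = a *: inj s n + inj s n'.
  exact: ginj_is_linear.
have inj_mul s t (u : denom_hom s t) n : inj t (sval u *: n) = inj s n.
  by rewrite -denom_dmapE; apply: (@ginj_map _ _ denom_diagram).
have injE s t u n : dval t = u * dval s -> inj s n = inj t (u *: n).
  by move=> tE; rewrite -(inj_mul s t (exist _ u tE)).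
pose b (x : U) (n : underlying M) := inj (repr (x : kp)).2 ((repr (x : kp)).1 *: n).
have bE x s n : b (frac x s) n = inj s (x *: n).
  rewrite /b; have [u] := repr_frac x s.
  case: (repr _) => [x' s'] /= uE.
  (* Independence of the representative: both classes are moved to stage u s s', where u x' s = u x
     s' applies. *)
  rewrite (injE s' (mul_denom u (mul_denom s s')) (dval u * dval s)); last first.
    by rewrite !dvalM mulrA.
  rewrite (injE s (mul_denom u (mul_denom s s')) (dval u * dval s')); last first.
    by rewrite !dvalM; ring.
  rewrite !scalerA; congr (inj _ (_ *: n)).
  by rewrite -mulrA [_ * x']mulrC uE; ring.
have bb : is_bilinear b.
  split=> [n|x] a y z.
    have [y' [s ->]] := fracP (y : kp); have [z' [t ->]] := fracP (z : kp).
    rewrite -[a *: _]/(to_loc p a * frac y' s) /to_loc fracM fracD !bE.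
    set r := mul_denom _ t.
    rewrite (injE s r (dval t)) ?(injE t r (dval s)); last first.
    - by rewrite !dvalM dval1; ring.
    - by rewrite !dvalM dval1; ring.
    rewrite -injP !scalerA -scalerDl dvalM dval1; congr (inj _ (_ *: _)).
    by ring.
  have [x' [s ->]] := fracP (x : kp); rewrite !bE -injP; congr inj.
  by rewrite scalerDr !scalerA mulrC.
move=> m0; have : b (1 : kp) m = 0.
  rewrite -(tensor_lift_pure _ _ bb) -[pure _ _]/(lpure 1 m) m0.
  exact: lift_tzero.
rewrite -[1]/(frac 1 (one_denom p)) bE scale1r.
move/(@ginj_eq0 _ _ denom_diagram denom_filtered) => [t [u]].
rewrite -[dmap _ _ _]/(denom_dmap u m) denom_dmapE => um.
by exists t; rewrite (_ : dval t = sval u) // -[RHS]mulr1; apply: svalP u.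
Qed.

Lemma lpure_frac_eq0 s m : lpure (frac 1 s) m = 0 ->
  exists t : denom p, (dval t)%:C *: m = 0.
Proof.
move=> m0; apply: lpure_eq0; rewrite -[RHS](scaler0 _ (gconst gT (to_loc p (dval s)))).
rewrite -m0 scale_lpure_const; congr lpure.
by rewrite /to_loc fracM; apply: frac_eq1; rewrite !dvalM dval1; ring.
Qed.

End OneModule.

(** * Functoriality of localisation *)

Section Functoriality.
Variables M N : lmodType kG.

(** Defined on bare functions because the maps in Higman's criterion, which also have to be
    localised, are only k-linear. *)
Definition lmap (f : M -> N) : localized_module p M -> localized_module p N :=
  tensor_lift (fun (x : U) (m : underlying M) => lpure x (f m)).

Lemma lmap_bilinear (f : M -> N) : klinear f ->
  is_bilinear (fun (x : U) (m : underlying M) => lpure x (f m) : tensor U (underlying N)).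
Proof.
move=> fk; split=> [m|x] a y z; first exact: (pure_bilinear U (underlying N)).1.
rewrite -[f _]/(f (a%:C *: y + z)) fk.
exact: (pure_bilinear U (underlying N)).2.
Qed.

Lemma lmap_pure (f : M -> N) x m : klinear f -> lmap f (lpure x m) = lpure x (f m).
Proof. by move=> fk; apply: tensor_lift_pure; apply: lmap_bilinear. Qed.

Lemma lmapD (f : M -> N) t u : klinear f -> lmap f (t + u) = lmap f t + lmap f u.
Proof. by move=> fk; apply: lift_tadd; apply: lmap_bilinear. Qed.

Lemma lmap_klinear (f : M -> N) : klinear f -> klinear (lmap f).
Proof.
move=> fk c t u; rewrite lmapD //; congr (_ + _).
have [s [m ->]] := lpure_surj t.
by rewrite scale_lpure_const !lmap_pure // scale_lpure_const.
Qed.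

Lemma lmap_linear (f : {linear M -> N}) : linear (lmap f).
Proof.
have fk := linear_klinear f; apply: klinear_equivariant (lmap_klinear fk) _ => g t.
have [s [m ->]] := lpure_surj t.
by rewrite scale_lpure_basis !lmap_pure // scale_lpure_basis linearZ.
Qed.

Definition loc_linear (f : {linear M -> N}) :
    {linear localized_module p M -> localized_module p N} :=
  sval (cid (exists_linear (lmap_linear f))).

Lemma loc_linear_pure (f : {linear M -> N}) x m :
  loc_linear f (lpure x m) = lpure x (f m).
Proof.
rewrite /loc_linear; case: cid => h /= ->.
by rewrite lmap_pure //; apply: linear_klinear.
Qed.

End Functoriality.

(** * Localisation preserves cw-injectivity *)

Lemma localized_higman (P : lmodType kG) : higman P -> higman (localized_module p P).
Proof.
move=> [t tk tE]; exists (lmap t); first exact: lmap_klinear.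
move=> x; have [s [m ->]] := lpure_surj x; rewrite -[in RHS](tE m) lpure_sum.
by apply: eq_bigr => g _; rewrite scale_lpure_basis lmap_pure // scale_lpure_basis.
Qed.

Definition localized_diagram (I : category) (D : diagram I kG) : diagram I kpG.
Proof.
apply: (@Diagram I kpG (fun i => localized_module p (D i))
          (fun i j u => loc_linear (dmap D u))).
  move=> i t; have [s [m ->]] := lpure_surj t.
  by rewrite loc_linear_pure dmap_id.
move=> i j l v u t; have [s [m ->]] := lpure_surj t.
by rewrite /= !loc_linear_pure dmap_comp.
Defined.

Lemma localized_cw_injective (M : lmodType kG) :
  cw_injective M -> cw_injective (localized_module p M).
Proof.
move=> [I [D [L [c [If Dwi cL [f [g fK gK]]]]]]].
have [g' [fK' gK']] : exists g' : {linear L -> M}, cancel f g' /\ cancel g' f.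
  by apply: linear_inverse => [|y]; [apply: can_inj fK | exists (g y)].
exists I, (localized_diagram D), (localized_module p L), (fun i => loc_linear (c i)).
split=> //.
- by move=> i; apply/weakly_injectiveE/localized_higman/weakly_injectiveE.
- apply: is_colimit_filtered => //.
  + move=> i j u t; have [s [m ->]] := lpure_surj t.
    by rewrite /= !loc_linear_pure; congr lpure; apply: cL.1.
  + move=> t; have [s [m ->]] := lpure_surj t.
    have [i [x ->]] := colimit_jointly_surjective If cL m.
    by exists i, (lpure (frac 1 s) x); rewrite loc_linear_pure.
  move=> i t; have [s [m ->]] := lpure_surj t; rewrite loc_linear_pure.
  (* Some denominator [r] makes r m vanish in the colimit, hence at a stage [j]. Writing 1/s as r/(s
     r) then moves [r] onto m. *)
  move=> /lpure_frac_eq0[r]; rewrite -linearZ /=.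
  move=> /(colimit_kernels_die If cL)[j [u]]; rewrite linearZ /= => ru.
  exists j, u; rewrite /= loc_linear_pure.
  have -> : frac 1 s = frac 1 (mul_denom s r) * to_loc p (dval r).
    by rewrite /to_loc fracM; apply: frac_eq1; rewrite !dvalM dval1; ring.
  by rewrite mulrC lpure_move ru lpure0r.
exists (loc_linear f), (loc_linear g') => t; have [s [m ->]] := lpure_surj t.
  by rewrite !loc_linear_pure fK'.
by rewrite !loc_linear_pure gK'.
Qed.

(** * Clearing denominators *)

Local Notation iota := (base_change (@to_loc k p)).

Lemma to_localized_linear (M : lmodType kG) :
  linear (lpure 1 : M -> restrict iota (localized_module p M)).
Proof.
apply: klinear_equivariant => [c x y|g x].
  rewrite -[RHS]/(iota (gconst gT c) *: lpure 1 x + lpure 1 y).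
  by rewrite base_change_const scale_lpure_const lpureDr -lpure_move mulrC.
rewrite -[RHS]/(iota (gbasis k g) *: lpure 1 x).
by rewrite base_change_basis scale_lpure_basis.
Qed.

(** A k-linear [t] into the localised module has trace [l \o f]. Finitely many generators and
    relations allow a multiple of [t] to be lifted to [h] into [M]; the trace of [h] agrees with a
    multiple of [f] only after [l], and one more denominator makes them equal. *)
Lemma localized_trace (M F : lmodType kG) (f : {linear F -> M}) :
  fin_pres F -> traceable (restrict iota (localized_module p M)) ->
  exists (s : denom p) (t : F -> M),
    klinear t /\ forall x, trace t x = (dval s)%:C *: f x.
Proof.
move=> Ffp; have [I [J [x [r xr]]]] := Ffp; have [xs x0 _] := xr.
have [l lE] := exists_linear (@to_localized_linear M).
move=> /(_ F Ffp (l \o f))[t tk tE].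
have lk := linear_klinear l; have fk := linear_klinear f.
have l0 m : l m = 0 -> exists s : denom p, (dval s)%:C *: m = 0.
  by rewrite lE; apply: lpure_eq0.
have [a b c|a|s /choice[m mE]] :=
    @common_denom I (fun a s => exists m, (dval s)%:C *: t (x a) = l m).
- by move=> [m mE]; exists ((dval c)%:C *: m); rewrite linearZ /= -mE scalerA -rmorphM.
- have [s [m mE]] := lpure_surj (t (x a) : localized_module p M); exists s, m.
  rewrite lE -[LHS]/(iota _ *: (t (x a) : localized_module p M)) mE.
  rewrite base_change_const scale_lpure_const; congr lpure.
  by rewrite /to_loc fracM; apply: frac_eq1; rewrite !dvalM dval1; ring.
(* The lifts [m] satisfy the relations only in the localisation; a further factor [s'] makes them
   hold in [M]. *)
have [j b c|j|s' s'E] := @common_denom J (fun j s => (dval s)%:C *: kcomb m (r j) = 0).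
- by move=> mb; rewrite dvalM rmorphM -scalerA mb scaler0.
- apply: l0; rewrite klinear_kcomb //.
  transitivity ((dval s)%:C *: t (kcomb x (r j))); last first.
    by rewrite x0 (klinear0 tk) scaler0.
  rewrite klinear_kcomb // -kcomb_scale.
  by apply: eq_bigr => a _; rewrite /= mE.
pose y a := (dval s')%:C *: m a.
have [|h hk hE] := @kpresents_lift _ _ F M I J x r y xr.
  by move=> j; rewrite kcomb_scale s'E.
have lh z : l (h z) = (dval s' * dval s)%:C *: t z.
  apply: (kspans_ext xs (f := l \o h) (g := fun z => (dval s' * dval s)%:C *: t z)) z.
  - exact: klinear_comp.
  - exact: klinear_scale.
  by move=> a; rewrite /= hE linearZ /= -mE scalerA -rmorphM.
pose d z := trace h z - (dval s' * dval s)%:C *: f z.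
have dk : klinear d.
  have [H HE] := exists_linear (trace_linear hk).
  move=> c z w; rewrite /d -!HE (linear_klinear H) (klinear_scale _ fk).
  by rewrite opprD addrACA scalerBr.
have ld z : l (d z) = 0.
  rewrite linearB linearZ -trace_compl /= -[l (f z)]tE -trace_scale.
  by apply/eqP; rewrite subr_eq0; apply/eqP; apply: eq_bigr => g _; rewrite /= lh.
(* The defect [d] has values in the kernel of [l]. One [q] kills it on all generators, hence
   everywhere by k-linearity. *)
have [a b c|a|q qE] := @common_denom I (fun a s => (dval s)%:C *: d (x a) = 0).
- by move=> dc; rewrite dvalM rmorphM -scalerA dc scaler0.
- exact: l0.
exists (mul_denom q (mul_denom s' s)), (fun z => (dval q)%:C *: h z).
split; first exact: klinear_scale.
move=> z; apply/eqP; rewrite trace_scale dvalM rmorphM -scalerA -subr_eq0 -scalerBr.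
apply/eqP; apply: (kspans_ext xs (f := fun z => (dval q)%:C *: d z) (g := fun=> 0)) z => //.
- exact: klinear_scale.
- by move=> c z w; rewrite scaler0 addr0.
Qed.

End Localized.

(** * From all localisations back to the module *)

Lemma traceable_local (k : comPzRingType) (gT : finGroupType)
    (M : lmodType (group_algebra k gT)) :
  (forall p : max_ideal k,
     traceable (restrict (base_change (to_loc p)) (localized_module p M))) ->
  traceable M.
Proof.
move=> Mp F Ffp f.
pose J : set k := fun c =>
  exists2 t : F -> M, klinear t & forall x, trace t x = gconst gT c *: f x.
have JI : is_ideal J.
  split.
  - exists (fun=> 0) => [c x y|x]; first by rewrite scaler0 addr0.
    by rewrite rmorph0 scale0r /trace big1 // => g _; rewrite scaler0.
  - move=> a b [t tk tE] [u uk uE]; exists (fun x => t x + u x).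
      by move=> c x y; rewrite tk uk scalerDr addrACA.
    move=> x; rewrite rmorphD scalerDl -tE -uE -big_split.
    by apply: eq_bigr => g _; rewrite scalerDr.
  move=> a b [t tk tE]; exists (fun x => gconst gT a *: t x).
    exact: klinear_scale.
  by move=> x; rewrite trace_scale tE scalerA rmorphM.
have [[t tk tE]|J1] := pselect (J 1).
  by exists t => // x; rewrite tE rmorph1 scale1r.
(* If [J] were proper, it would lie in some [p], but clearing denominators at [p] produces an
   element of [J] outside [p]. *)
have [p Jp] := ideal_sub_max JI J1.
have [s [t [tk tE]]] := localized_trace f Ffp (Mp p).
by case: (@dvalP _ _ s); apply: Jp; exists t.
Qed.

Theorem theorem1p2 (k : comPzRingType) (gT : finGroupType)
    (M : lmodType (group_algebra k gT)) :
  cw_injective M <->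
  forall p : max_ideal k, cw_injective (localized_module p M).
Proof.
split=> [Mcw p | Mp]; first exact: localized_cw_injective.
apply: traceable_cw_injective; apply: traceable_local => p.
exact: cw_injective_restrict_traceable (Mp p).
Qed.
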